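(* Suppose $(f,c,\mathcal{X})$ is regular problem data, $\mathcal{A}$ is a constraint dissolving mapping for it, and $f$, $c$ and $\mathcal{A}$ are twice differentiable over $\mathcal{Y}$. Let $\beta\ge0$. Then any $x\in\mathcal{K}$ that is a second-order stationary point of (CDP) is a second-order stationary point of (NCP).
   Context: **Problem.** $\mathcal{X}\subseteq\mathbb{R}^n$ is a closed convex set, $f:\mathbb{R}^n\to\mathbb{R}$, and $c:\mathcal{Y}\to\mathbb{R}^p$ where $\mathcal{Y}\subseteq\mathbb{R}^n$ is an open set containing $\mathcal{X}$. (NCP) is the problem $\min f(x)$ subject to $c(x)=0$, $x\in\mathcal{X}$, and $\mathcal{K}:=\{x\in\mathcal{X}: c(x)=0\}$. **Notation.** $\mathcal{T}_{\mathcal{X}}(x)$, $\mathcal{N}_{\mathcal{X}}(x)$ are the tangent and normal cones of $\mathcal{X}$ at $x$; $\mathrm{aff}(\mathcal{X})$ is the affine hull; $\mathcal{E}:=\mathrm{aff}(\mathcal{X})-x$ (any $x\in\mathcal{X}$) is the associated linear subspace. $\nabla c(x)=[\nabla c_1(x),\dots,\nabla c_p(x)]\in\mathbb{R}^{n\times p}$ and $\nabla\mathcal{A}(x)=[\nabla\mathcal{A}_1(x),\dots,\nabla\mathcal{A}_n(x)]\in\mathbb{R}^{n\times n}$ are transposed Jacobians. $\nabla^2c(x)[\lambda]:=\sum_{i=1}^p\lambda_i\nabla^2c_i(x)$. **Regular problem data.** $f$ is continuously differentiable with locally Lipschitz gradient on $\mathbb{R}^n$; $c$ is continuously differentiable with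 locally Lipschitz Jacobian on $\mathcal{Y}$; and there is $r>0$, independent of $x$, such that for every $x\in\mathcal{K}$ there is $\tau_x>0$ with: (a) $\dim\{\nabla c(y)^\top d: d\in\mathcal{E}\}=r$ for all $y\in\mathcal{Y}\cap\mathrm{aff}(\mathcal{X})$ with $\|y-x\|\le\tau_x$; (b) $\dim\{\nabla c(y)^\top d: d\in\mathcal{T}_{\mathcal{X}}(y)\cap-\mathcal{T}_{\mathcal{X}}(y)\}=r$ for all $y\in\mathcal{X}$ with $\|y-x\|\le\tau_x$. **Constraint dissolving mapping.** A mapping $\mathcal{A}:\mathcal{X}\to\mathbb{R}^n$ (here, by the twice-differentiability hypothesis, extended to $\mathcal{Y}$) such that: (1) $\mathcal{A}$ is locally Lipschitz smooth (continuously differentiable with locally Lipschitz derivative) over $\mathcal{X}$; (2) $\mathcal{A}(x)=x$ and $\nabla\mathcal{A}(x)\nabla c(x)=0$ for all $x\in\mathcal{K}$; (3) there is a locally Lipschitz mapping $\mathcal{R}_{\mathcal{A}}:\mathcal{X}\to\mathbb{R}^{n\times n}$ with $\mathcal{R}_{\mathcal{A}}(x)=0$ for $x\in\mathcal{K}$, and for each $x\in\mathcal{K}$ there is $\omega_x>0$ such that $(\nabla\mathcal{A}(y)-I_n-\mathcal{R}_{\mathcal{A}}(y))v=0$ for all $y\in\mathcal{X}$ with $\|y-x\|\le\omega_x$ and all $v\in\mathcal{N}_{\mathcal{X}}(y)$. **(CDP).** $\min_{x\in\mathcal{X}} h(x):=f(\mathcal{A}(x))+\frac{\beta}{2}\|c(x)\|^2$,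 $\beta\ge0$. **First-order stationarity.** $x\in\mathcal{K}$ is first-order stationary for (NCP) if $0\in\nabla f(x)+\mathrm{range}(\nabla c(x))+\mathcal{N}_{\mathcal{X}}(x)$; $x\in\mathcal{X}$ is first-order stationary for (CDP) if $0\in\nabla h(x)+\mathcal{N}_{\mathcal{X}}(x)$. **Second-order objects.** For closed $\mathcal{S}$, $x\in\mathcal{S}$, $w\in\mathbb{R}^n$: $\mathcal{T}^2_{\mathcal{S}}(x,w):=\{z:\liminf_{t\downarrow0}\mathrm{dist}(z,(\mathcal{S}-x-tw)/(\tfrac12t^2))=0\}$. Support function: $\zeta(w,\mathcal{S}):=\sup_{y\in\mathcal{S}}\langle w,y\rangle$ (equal to $-\infty$ if $\mathcal{S}=\emptyset$). **Second-order stationary point of (CDP):** a first-order stationary point $x\in\mathcal{X}$ such that, with $\Gamma=-\nabla h(x)$, $\langle d,\nabla^2h(x)d\rangle-\zeta(\Gamma,\mathcal{T}^2_{\mathcal{X}}(x,d))\ge0$ for all $d\in\mathcal{C}_1(x):=\{d\in\mathcal{T}_{\mathcal{X}}(x):\langle d,\nabla h(x)\rangle=0\}$. **Second-order stationary point of (NCP):** a first-order stationary point $x\in\mathcal{K}$ such that $\sup_{(\lambda,\Gamma)\in\mathcal{M}_2(x)}\{\langle d,(\nabla^2f(x)+\nabla^2c(x)[\lambda])d\rangle-\zeta(\Gamma,\mathcal{T}^2_{\mathcal{X}}(x,d))\}\ge0$ for all $d\in\mathcal{C}_2(x)$, where $\mathcal{M}_2(x):=\{(\lambda,\Gamma)\in\mathbb{R}^p\times\mathbb{R}^n:\nabla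 f(x)+\nabla c(x)\lambda+\Gamma=0,\ \Gamma\in\mathcal{N}_{\mathcal{X}}(x)\}$ and $\mathcal{C}_2(x):=\{d\in\mathcal{T}_{\mathcal{X}}(x):\langle\nabla f(x),d\rangle=0,\ d^\top\nabla c(x)=0\}$. *)

(* Defs.v *)
From HB Require Import structures.
From mathcomp Require Import all_boot all_order all_algebra.
From mathcomp Require Import all_classical all_reals all_analysis.

Set Implicit Arguments.
Unset Strict Implicit.
Unset Printing Implicit Defensive.

Import Order.TTheory GRing.Theory Num.Theory.
Import numFieldNormedType.Exports.

Local Open Scope classical_set_scope.
Local Open Scope ring_scope.

(* Vectors of R^n are row vectors.  For G : 'rV_m -> 'rV_k the library's
   ['J G x : 'M_(m, k)] satisfies ['d G x v = v *m 'J G x], so it is already the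
   transposed Jacobian [grad G_1(x), ..., grad G_k(x)], written nabla G(x) in
   column notation.  With the convention that rows stand for columns,
     nabla G(x)^T d   is   [d *m 'J G x],
     nabla G(x) l     is   [l *m ('J G x)^T]. *)

Section Euclidean.
Context {R : realType} {n : nat}.
Implicit Types (u v w x z : 'rV[R]_n) (S : set 'rV[R]_n).

Definition dot u v : R := (u *m v^T) 0 0.

(* The library norm on 'rV[R]_n is the sup norm. *)
Definition enorm u : R := Num.sqrt (dot u u).

Definition dist z S : \bar R := ereal_inf [set (enorm (z - s))%:E | s in S].

Definition support w S : \bar R := ereal_sup [set (dot w y)%:E | y in S].

Definition affine_hull S : set 'rV[R]_n :=
  [set y | exists (k : nat) (a : 'I_k -> R) (s : 'I_k -> 'rV[R]_n),
     [/\ forall i, S (s i), \sum_i a i = 1 & y = \sum_i a i *: s i]].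

Definition direction S x : set 'rV[R]_n := [set y - x | y in affine_hull S].

Definition tangent_cone S x : set 'rV[R]_n :=
  [set d | exists (t : R^nat) (e : nat -> 'rV[R]_n),
     [/\ forall k, 0 < t k, t @ \oo --> (0 : R), e @ \oo --> d
       & forall k, S (x + t k *: e k)]].

(* Normal cone of a convex set, at a point x of S. *)
Definition normal_cone S x : set 'rV[R]_n :=
  [set v | forall y, S y -> dot v (y - x) <= 0].

Definition second_order_tangent S x w : set 'rV[R]_n :=
  [set z | limf_einf
     (fun t : R => dist z [set (2^-1 * t ^+ 2)^-1 *: (s - x - t *: w) | s in S])
     (0 : R)^'+ = 0%E].

End Euclidean.

(* S is a linear subspace of dimension r. *)
Definition has_dim {R : realType} {k : nat} (S : set 'rV[R]_k) (r : nat) : Prop :=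
  exists2 U : {vspace 'rV[R]_k}, S = [set v | v \in U] & \dim U = r.

Section Calculus.
Context {R : realType} {n : nat}.
Implicit Types (f : 'rV[R]_n -> R) (D : set 'rV[R]_n) (x : 'rV[R]_n).

Definition grad f x : 'rV[R]_n := \row_i 'd f x (delta_mx 0 i).

Definition hess f x : 'M[R]_n := 'J (grad f) x.

(* In the next two definitions [DG] is the derivative of [G] in the encoding used
   for its codomain: [grad G] for a real function, [jacobian G] for a vector map. *)
Definition locally_lipschitz_smooth {W V : normedModType R}
    (D : set 'rV[R]_n) (G : 'rV[R]_n -> W) (DG : 'rV[R]_n -> V) : Prop :=
  [/\ forall x, D x -> differentiable G x,
      {within D, continuous DG}
    & [locally [lipschitz DG x | x in D]]].

Definition twice_differentiable {W V : normedModType R}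
    (D : set 'rV[R]_n) (G : 'rV[R]_n -> W) (DG : 'rV[R]_n -> V) : Prop :=
  forall x, D x -> differentiable G x /\ differentiable DG x.

End Calculus.

Section Problem.
Context {R : realType} {n p : nat}.
Implicit Types (X Y : set 'rV[R]_n) (f h : 'rV[R]_n -> R).
Implicit Types (c : 'rV[R]_n -> 'rV[R]_p) (A : 'rV[R]_n -> 'rV[R]_n).
Implicit Types (x : 'rV[R]_n).

Definition feasible X c : set 'rV[R]_n := [set x | X x /\ c x = 0].

Definition regular_data X Y f c : Prop :=
  [/\ locally_lipschitz_smooth setT f (grad f),
      locally_lipschitz_smooth Y c (jacobian c)
    & exists2 r : nat, (0 < r)%N &
      forall x, feasible X c x -> exists2 tau : R, 0 < tau &
        (forall y, Y y -> affine_hull X y -> enorm (y - x) <= tau ->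
           has_dim [set d *m 'J c y | d in direction X x] r) /\
        (forall y, X y -> enorm (y - x) <= tau ->
           has_dim [set d *m 'J c y | d in
                      tangent_cone X y `&` [set d | tangent_cone X y (- d)]] r)].

(* [A] is total, so ['J A] on X refers to the extension of A around X. *)
Definition constraint_dissolving X c A : Prop :=
  [/\ locally_lipschitz_smooth X A (jacobian A),
      forall x, feasible X c x -> A x = x /\ 'J A x *m 'J c x = 0
    & exists RA : 'rV[R]_n -> 'M[R]_n,
      [/\ [locally [lipschitz RA x | x in X]],
          forall x, feasible X c x -> RA x = 0
        & forall x, feasible X c x -> exists2 omega : R, 0 < omega &
            forall y, X y -> enorm (y - x) <= omega ->
            forall v, normal_cone X y v ->
              ('J A y - 1%:M - RA y) *m v^T = 0]].

Definition cdp_obj f c A (beta : R) : 'rV[R]_n -> R :=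
  fun x => f (A x) + beta / 2 * enorm (c x) ^+ 2.

Definition cdp_stationary1 X h x : Prop :=
  X x /\ exists2 v, normal_cone X x v & 0 = grad h x + v.

Definition ncp_stationary1 X f c x : Prop :=
  feasible X c x /\
  exists (l : 'rV[R]_p) (v : 'rV[R]_n),
    normal_cone X x v /\ 0 = grad f x + l *m ('J c x)^T + v.

Definition quad_form (H : 'M[R]_n) (d : 'rV[R]_n) : R := dot d (d *m H^T).

Definition hess_comb c (l : 'rV[R]_p) x : 'M[R]_n :=
  \sum_(i < p) l 0 i *: hess (fun y => c y 0 i) x.

Definition cdp_critical X h x : set 'rV[R]_n :=
  [set d | tangent_cone X x d /\ dot d (grad h x) = 0].

Definition cdp_stationary2 X h x : Prop :=
  cdp_stationary1 X h x /\
  forall d, cdp_critical X h x d ->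
    (0 <= (quad_form (hess h x) d)%:E
          - support (- grad h x) (second_order_tangent X x d))%E.

Definition ncp_multipliers X f c x : set ('rV[R]_p * 'rV[R]_n) :=
  [set m | grad f x + m.1 *m ('J c x)^T + m.2 = 0 /\ normal_cone X x m.2].

Definition ncp_critical X f c x : set 'rV[R]_n :=
  [set d | [/\ tangent_cone X x d, dot (grad f x) d = 0 & d *m 'J c x = 0]].

Definition ncp_stationary2 X f c x : Prop :=
  ncp_stationary1 X f c x /\
  forall d, ncp_critical X f c x d ->
    (0 <= ereal_sup
       [set (quad_form (hess f x + hess_comb c m.1 x) d)%:E
            - support m.2 (second_order_tangent X x d)
       | m in ncp_multipliers X f c x])%E.

End Problem.

(* Main.v *)
From HB Require Import structures.
Require Import Defs.
From mathcomp Require Import all_boot all_order all_algebra.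
From mathcomp Require Import all_classical all_reals all_analysis.
From mathcomp Require Import ring lra.

(** Write h for the dissolved objective, let x be feasible and let D be the set of
    directions d tangent to X at x with [d *m 'J c x = 0].

    The geometric core is that each d in D is approximated by feasible points:
    points x + t e of X with e close to d can be moved onto the constraint set at a
    cost o(t) ([feasible_correction]).  The constraints may be redundant, so one
    first selects r independent combinations [c y *m W].  The rank condition on the
    lineality spaces provides directions that can be followed both ways inside the
    tangent cone and on which the selected constraints have the identity as
    derivative.  This gives an error bound ([robinson_error_bound]), and the
    constancy of the rank on the affine hull makes the other constraints vanish
    together with the selected ones ([constant_rank_zero]).

    Because A is the identity on the feasible set, its derivative at x fixes each d
    in D ([diff_id_along]).  Hence grad f and grad h = [grad f x *m ('J A x)^T] agree
    on D, and differ by a vector [- l *m ('J c x)^T - q] with q orthogonal to the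
    tangent cone ([dissolving_multiplier]).  The pair (l, G) with G = q - grad h is a
    multiplier: q affects neither normality nor the support function of the
    second-order tangent set, which is orthogonal to q.  First-order stationarity
    follows, and every critical direction d of the constrained problem is critical
    for h.

    It remains to compare the quadratic forms at d.  Let H be the differential of
    the Jacobian of A along d.  The chain rule gives the value of the Hessian of f
    plus the product of grad f with [d *m H] ([quad_form_hess_cdp_obj]).
    Differentiating ['J A y *m 'J c y = 0] along feasible points shows that
    [d *m H *m 'J c x] is minus the second derivative of c along d
    ([diff_dissolving_product]).  So the two forms differ by the product of G with
    [d *m H].  That product is 0 by [normal_curvature]: one follows d along
    projections onto X whose normals tend to G, and these normals are fixed by
    the transposed derivative of A up to the remainder RA, which is o(t) there.
    Thus the second-order condition for h is the one for the constrained problem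
    with the multiplier (l, G), and the supremum is nonnegative. *)

Set Implicit Arguments.
Unset Strict Implicit.
Unset Printing Implicit Defensive.

Import Order.TTheory GRing.Theory Num.Theory.
Import numFieldNormedType.Exports.
Local Open Scope classical_set_scope.
Local Open Scope ring_scope.

(** * Maximum norms, products and limits of matrices *)

Section MatrixNorm.
Context {R : realType}.

Lemma ler_mx_entry m n (M : 'M[R]_(m, n)) i j : `|M i j| <= `|M|.
Proof.
rewrite [leRHS]/Num.norm /= mx_normrE.
by apply: (le_bigmax _ (fun ij => `|M ij.1 ij.2|) (i, j)).
Qed.

Lemma mx_norm_le m n (M : 'M[R]_(m, n)) (b : R) :
  0 <= b -> (forall i j, `|M i j| <= b) -> `|M| <= b.
Proof.
move=> b0 Mb; rewrite [leLHS]/Num.norm /= mx_normrE.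
by apply: bigmax_le => // -[i j] _; exact: Mb.
Qed.

Lemma ler_norm_mulmx m n k (A : 'M[R]_(m, n)) (B : 'M[R]_(n, k)) :
  `|A *m B| <= n%:R * `|A| * `|B|.
Proof.
apply: mx_norm_le => [|i j]; first by rewrite !mulr_ge0.
rewrite mxE (le_trans (ler_norm_sum _ _ _))//.
apply: (@le_trans _ _ (\sum_(l < n) `|A| * `|B|)).
  by apply: ler_sum => l _; rewrite normrM ler_pM // ler_mx_entry.
by rewrite sumr_const card_ord -[leLHS]mulr_natl mulrA.
Qed.

Lemma cvg_mulmx (T : Type) (F : set_system T) {FF : Filter F} m n k
    (A : T -> 'M[R]_(m, n)) (B : T -> 'M[R]_(n, k))
    (a : 'M[R]_(m, n)) (b : 'M[R]_(n, k)) :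
  A @ F --> a -> B @ F --> b -> (fun t => A t *m B t) @ F --> a *m b.
Proof.
move=> Aa Bb; apply/cvgrPdist_le => e e0.
pose C := n%:R * (`|b| + 1) + n%:R * `|a| + 1.
have C0 : 0 < C by rewrite ltr_pwDr // addr_ge0 // mulr_ge0 // addr_ge0.
have eC : 0 < e / C by rewrite divr_gt0.
near=> t.
have Ate : `|a - A t| <= e / C.
  by near: t; apply: (cvgr_dist_le _ _ Aa).
have Bte : `|b - B t| <= e / C.
  by near: t; apply: (cvgr_dist_le _ _ Bb).
have Bt1 : `|B t| <= `|b| + 1.
  have h : `|b - B t| <= 1 by near: t; apply: (cvgr_dist_le _ _ Bb).
  by rewrite -[B t](subKr b) (le_trans (ler_normB _ _)) // lerD2l.
have -> : a *m b - A t *m B t = (a - A t) *m B t + a *m (b - B t).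
  by rewrite mulmxBl mulmxBr [RHS]addrC addrA subrK.
rewrite (le_trans (ler_normD _ _)) //.
apply: (@le_trans _ _ (n%:R * (e / C) * (`|b| + 1) + n%:R * `|a| * (e / C))).
  apply: lerD; rewrite (le_trans (ler_norm_mulmx _ _)) //.
    by rewrite ler_pM // ?mulr_ge0 // ler_wpM2l.
  by rewrite ler_wpM2l // mulr_ge0.
have -> : n%:R * (e / C) * (`|b| + 1) + n%:R * `|a| * (e / C) = e / C * (C - 1).
  rewrite /C; ring.
by rewrite mulrAC ler_pdivrMr // ler_pM2l // gerBl.
Unshelve. all: by end_near. Qed.

Lemma continuous_mulmx m n k :
  continuous (fun p : 'M[R]_(m, n) * 'M[R]_(n, k) => p.1 *m p.2).
Proof. by move=> p; apply: cvg_mulmx; [exact: cvg_fst | exact: cvg_snd]. Qed.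

Lemma mulmxr_continuous m n k (B : 'M[R]_(n, k)) :
  continuous (fun A : 'M[R]_(m, n) => A *m B).
Proof.
move=> A.
have FA : Filter (nbhs A) by exact: nbhs_filter.
by apply: (@cvg_mulmx _ _ FA _ _ _ id (fun=> B)); [exact: (fun _ => id)|exact: cvg_cst].
Qed.

Lemma cvg_entry (T : Type) (F : set_system T) {FF : Filter F} m n
    (A : T -> 'M[R]_(m, n)) (a : 'M[R]_(m, n)) i j :
  A @ F --> a -> (fun t => A t i j) @ F --> a i j.
Proof.
move=> Aa; apply/cvgrPdist_le => e e0; near=> t.
have h : `|a - A t| <= e by near: t; apply: (cvgr_dist_le _ _ Aa).
by have := le_trans (ler_mx_entry (a - A t) i j) h; rewrite !mxE.
Unshelve. all: by end_near. Qed.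

Lemma cvg_trmx (T : Type) (F : set_system T) {FF : Filter F} m n
    (A : T -> 'M[R]_(m, n)) (a : 'M[R]_(m, n)) :
  A @ F --> a -> (fun t => (A t)^T) @ F --> a^T.
Proof.
move=> Aa; apply/cvgrPdist_le => e e0; near=> t.
have : `|a - A t| <= e by near: t; apply: (cvgr_dist_le _ _ Aa).
move=> h; apply: mx_norm_le => [|i j]; first exact: ltW.
by have := le_trans (ler_mx_entry (a - A t) j i) h; rewrite !mxE.
Unshelve. all: by end_near. Qed.

End MatrixNorm.

(** * The Euclidean inner product *)

Section Dot.
Context {R : realType} {n : nat}.
Implicit Types u v w : 'rV[R]_n.

Lemma dotE u v : dot u v = \sum_i u 0 i * v 0 i.
Proof. by rewrite /dot mxE; apply: eq_bigr => i _; rewrite mxE. Qed.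

Lemma dotC u v : dot u v = dot v u.
Proof. by rewrite !dotE; apply: eq_bigr => i _; rewrite mulrC. Qed.

Lemma dotDl u v w : dot (u + v) w = dot u w + dot v w.
Proof. by rewrite /dot mulmxDl mxE. Qed.

Lemma dotNl u w : dot (- u) w = - dot u w.
Proof. by rewrite /dot mulNmx mxE. Qed.

Lemma dotZl (a : R) u w : dot (a *: u) w = a * dot u w.
Proof. by rewrite /dot -scalemxAl mxE. Qed.

Lemma dotDr u v w : dot u (v + w) = dot u v + dot u w.
Proof. by rewrite ![dot u _]dotC dotDl. Qed.

Lemma dotNr u w : dot u (- w) = - dot u w.
Proof. by rewrite ![dot u _]dotC dotNl. Qed.

Lemma dotZr (a : R) u w : dot u (a *: w) = a * dot u w.
Proof. by rewrite ![dot u _]dotC dotZl. Qed.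

Lemma dotBl u v w : dot (u - v) w = dot u w - dot v w.
Proof. by rewrite dotDl dotNl. Qed.

Lemma dotBr u v w : dot u (v - w) = dot u v - dot u w.
Proof. by rewrite dotDr dotNr. Qed.

Lemma dot0r u : dot u 0 = 0.
Proof. by rewrite /dot trmx0 mulmx0 mxE. Qed.

Lemma dot_sumr (I : Type) (r : seq I) (P : pred I) u (F : I -> 'rV[R]_n) :
  dot u (\sum_(i <- r | P i) F i) = \sum_(i <- r | P i) dot u (F i).
Proof. by elim/big_rec2: _ => [|i y x _ <-]; rewrite ?dot0r // dotDr. Qed.

Lemma dot_ge0 u : 0 <= dot u u.
Proof. by rewrite dotE sumr_ge0 // => i _; rewrite -expr2 sqr_ge0. Qed.

Lemma sqr_entry_le_dot u i : u 0 i ^+ 2 <= dot u u.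
Proof.
rewrite dotE (bigD1 i) //= -expr2 lerDl sumr_ge0 // => j _.
by rewrite -expr2 sqr_ge0.
Qed.

Lemma ler_norm_enorm u : `|u| <= enorm u.
Proof.
apply: mx_norm_le => [|i j]; first exact: sqrtr_ge0.
by rewrite ord1 -sqrtr_sqr ler_wsqrtr // sqr_entry_le_dot.
Qed.

Lemma ler_dot_norm u v : `|dot u v| <= n%:R * `|u| * `|v|.
Proof.
rewrite dotE (le_trans (ler_norm_sum _ _ _)) //.
apply: (@le_trans _ _ (\sum_(l < n) `|u| * `|v|)).
  by apply: ler_sum => l _; rewrite normrM ler_pM // ler_mx_entry.
by rewrite sumr_const card_ord -[leLHS]mulr_natl mulrA.
Qed.

Lemma enorm_le u : enorm u <= (n%:R + 1) * `|u|.
Proof.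
rewrite /enorm -[leRHS]ger0_norm ?mulr_ge0 ?addr_ge0 // -sqrtr_sqr ler_wsqrtr //.
apply: (le_trans (ler_norm _)); apply: (le_trans (ler_dot_norm _ _)).
rewrite exprMn -mulrA -expr2 ler_wpM2r ?sqr_ge0 //.
by rewrite expr2; have := ler0n R n; nra.
Qed.

Lemma enorm_sqr u : enorm u ^+ 2 = dot u u.
Proof. by rewrite sqr_sqrtr // dot_ge0. Qed.

End Dot.

Lemma dot_mulmx {R : realType} m n (u : 'rV[R]_m) (v : 'rV[R]_n) (M : 'M[R]_(m, n)) :
  dot (u *m M) v = dot u (v *m M^T).
Proof. by rewrite /dot trmx_mul trmxK mulmxA. Qed.

Lemma cvg_dot {R : realType} n (T : Type) (F : set_system T) {FF : Filter F}
    (A B : T -> 'rV[R]_n) (a b : 'rV[R]_n) :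
  A @ F --> a -> B @ F --> b -> (fun t => dot (A t) (B t)) @ F --> dot a b.
Proof.
move=> Aa Bb; apply: cvg_entry; apply: cvg_mulmx => //; exact: cvg_trmx.
Qed.

(** * Difference quotients and Taylor estimates *)

Section Differentials.
Context {R : realType}.

Lemma differentiable_littleo (V W : normedModType R) (G : V -> W) x :
  differentiable G x -> forall e : R, 0 < e ->
  exists2 r : R, 0 < r &
    forall h, `|h| < r -> `|G (x + h) - G x - 'd G x h| <= e * `|h|.
Proof.
move=> /diff_locally /eqaddoP Gx e e0.
have /nbhs_ballP[r r0 rP] := Gx e e0; exists r => // h hr.
have := rP h; rewrite -ball_normE /= sub0r normrN => /(_ hr).
by rewrite !fctE /= [h + x]addrC opprD addrA.
Qed.

(** The direction may vary with the scale.  This is what lets one differentiate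
    along the sequences [x + t k *: e k] that define tangent vectors. *)
Lemma cvg_diff_quotient (T : Type) (F : set_system T) {FF : Filter F}
    (V W : normedModType R) (G : V -> W) x (t : T -> R) (e : T -> V) (d : V) :
  differentiable G x -> (\forall k \near F, t k != 0) ->
  t @ F --> (0 : R) -> e @ F --> d ->
  (fun k => (t k)^-1 *: (G (x + t k *: e k) - G x)) @ F --> 'd G x d.
Proof.
move=> Gx t0 tt ee.
have dGc : 'd G x (e k) @[k --> F] --> 'd G x d.
  by apply: continuous_cvg => //; exact: diff_continuous.
have tee : t k *: e k @[k --> F] --> (0 : V).
  by rewrite -(scale0r d); exact: cvgZ.
rewrite -[X in _ --> X](addr0 ('d G x d)).
have -> : (fun k => (t k)^-1 *: (G (x + t k *: e k) - G x)) =
  (fun k => (t k)^-1 *: (G (x + t k *: e k) - G x) - 'd G x (e k)) \+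
  (fun k => 'd G x (e k)).
  by apply/funext => k /=; rewrite subrK.
rewrite addrC; apply: cvgD => //.
apply/cvgr0Pnorm_le => eps eps0.
pose M := `|d| + 1.
have M0 : 0 < M by rewrite ltr_wpDl.
have [r r0 rP] := differentiable_littleo Gx (divr_gt0 eps0 M0).
near=> k.
have tk0 : t k != 0 by near: k.
have ek : `|e k| <= M.
  have h : `|d - e k| <= 1 by near: k; apply: (cvgr_dist_le _ _ ee).
  by rewrite -[e k](subKr d) (le_trans (ler_normB _ _)) // lerD2l.
have tek : `|t k *: e k| < r.
  have : `|0 - t k *: e k| < r by near: k; apply: (cvgr_dist_lt _ _ tee).
  by rewrite sub0r normrN.
have := rP _ tek; rewrite linearZ /=.
set D := 'd G x (e k); set Q := G _ - G x => hQ.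
have -> : (t k)^-1 *: Q - D = (t k)^-1 *: (Q - t k *: D).
  by rewrite [RHS]scalerBr scalerA mulVf // scale1r.
rewrite normrZ normfV ler_pdivrMl ?normr_gt0 // (le_trans hQ) // normrZ.
rewrite mulrCA ler_pM2l ?normr_gt0 // mulrAC ler_pdivrMr //.
by rewrite ler_pM2l.
Unshelve. all: by end_near. Qed.

Lemma diffE_jacobian n m (G : 'rV[R]_n -> 'rV[R]_m) x v :
  'd G x v = v *m 'J G x.
Proof. by rewrite /jacobian mul_rV_lin1. Qed.

Lemma is_derive_entry_line n m (G : 'rV[R]_n -> 'rV[R]_m) y v (s : R) i :
  differentiable G (y + s *: v) ->
  is_derive s 1 (fun u : R => G (y + u *: v) 0 i)
    ((v *m 'J G (y + s *: v)) 0 i).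
Proof.
move=> Gs.
have h0 : (fun h : R => h) @ 0^' --> (0 : R) by apply: cvg_within.
have FF : ProperFilter (0 : R)^' by exact: Proper_dnbhs_numFieldType.
have hn : \forall k \near (0 : R)^', id k != 0 by apply: nbhs_dnbhs_neq.
have hv : cst v @ (0 : R)^' --> v by apply: cvg_cst.
have : (fun k : R => k^-1 *: (G (y + s *: v + k *: v) - G (y + s *: v)))
    @ 0^' --> 'd G (y + s *: v) v.
  exact: (cvg_diff_quotient Gs hn h0 hv).
move=> /(cvg_entry (i:=0) (j:=i)).
rewrite diffE_jacobian => H.
have H' : (fun h : R => h^-1 *: (((fun u : R => G (y + u *: v) 0 i) \o shift s)
    (h *: 1) - G (y + s *: v) 0 i)) @ 0^' --> (v *m 'J G (y + s *: v)) 0 i.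
  apply: cvg_trans H; apply: near_eq_cvg; near=> h.
  rewrite /= !mxE; congr (_ * (_ - _)).
  by rewrite -addrA -scalerDl [h *: 1]mulr1 [s + h]addrC.
by apply: DeriveDef; [apply: cvgP H' | apply: cvg_lim].
Unshelve. all: by end_near. Qed.

(** The mean value theorem fails for vector-valued maps, but it applies to each
    entry along the segment, and for the maximum norm entrywise bounds suffice. *)
Lemma taylor_bound n p (c : 'rV[R]_n -> 'rV[R]_p) (x : 'rV[R]_n) (r L : R) :
  (forall y : 'rV[R]_n, `|y - x| < r -> differentiable c y) ->
  (forall y z : 'rV[R]_n, `|y - x| < r -> `|z - x| < r ->
     `|'J c y - 'J c z| <= L * `|y - z|) ->
  forall y z : 'rV[R]_n, `|y - x| < r -> `|z - x| < r ->
    `|c z - c y - (z - y) *m 'J c y| <= n%:R * L * `|z - y| ^+ 2.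
Proof.
move=> dc Lc y z yr zr.
have seg (s : R) : 0 <= s <= 1 -> `|y + s *: (z - y) - x| < r.
  move=> /andP[s0 s1].
  have -> : y + s *: (z - y) - x = (1 - s) *: (y - x) + s *: (z - x).
    rewrite !scalerBr scalerBl !scale1r.
    rewrite scalerBl scale1r.
    apply/rowP => j; rewrite !mxE; ring.
  rewrite (le_lt_trans (ler_normD _ _)) // !normrZ.
  rewrite [`|s|]ger0_norm // [`|1 - s|]ger0_norm ?subr_ge0 //.
  apply: (@le_lt_trans _ _ (Num.max `|y - x| `|z - x|)); last first.
    by rewrite gt_max yr zr.
  set m := Num.max _ _.
  have ym : `|y - x| <= m by rewrite le_max lexx.
  have zm : `|z - x| <= m by rewrite le_max lexx orbT.
  have : (1 - s) * `|y - x| <= (1 - s) * m by rewrite ler_wpM2l // subr_ge0.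
  have : s * `|z - x| <= s * m by rewrite ler_wpM2l.
  lra.
have L0 : 0 <= L * `|z - y| by rewrite distrC (le_trans _ (Lc _ _ yr zr)).
apply: mx_norm_le => [|i j].
  have -> : n%:R * L * `|z - y| ^+ 2 = n%:R * (L * `|z - y|) * `|z - y| by ring.
  by apply: mulr_ge0 => //; exact: mulr_ge0.
rewrite {i}ord1.
have dphi (s : R) : 0 <= s <= 1 -> is_derive s 1 (fun u : R => c (y + u *: (z - y)) 0 j)
    (((z - y) *m 'J c (y + s *: (z - y))) 0 j).
  by move=> s01; apply: is_derive_entry_line; apply: dc; exact: seg.
have [||s] := @MVT R (fun u : R => c (y + u *: (z - y)) 0 j)
  (fun s => ((z - y) *m 'J c (y + s *: (z - y))) 0 j) 0 1 ltr01.
- by move=> s /[!in_itv] /= /andP[s0 s1]; apply: dphi; rewrite !ltW.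
- apply: derivable_within_continuous => s /[!in_itv] /= s01.
  by have [] := dphi s s01.
rewrite in_itv /= => /andP[s0 s1].
rewrite scale1r scale0r addr0 subr0 mulr1 addrCA subrr addr0.
set w : 'rV[R]_n := y + _ => E.
have wr : `|w - x| < r by apply: seg; rewrite !ltW.
have -> : (c z - c y - (z - y) *m 'J c y) 0 j = ((z - y) *m ('J c w - 'J c y)) 0 j.
  by rewrite mulmxBr [RHS]mxE -E [LHS]mxE [in LHS]mxE; congr (_ + _ + _); rewrite mxE.
rewrite (le_trans (ler_mx_entry _ _ _)) // (le_trans (ler_norm_mulmx _ _)) //.
rewrite expr2 -!mulrA ler_wpM2l // mulrCA ler_wpM2l //.
apply: (le_trans (Lc w y wr yr)).
have -> : w - y = s *: (z - y) by rewrite /w addrC addKr.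
by rewrite normrZ mulrCA ger0_norm ?(ltW s0) // ler_piMl // ltW.
Qed.

End Differentials.

(** * Differentials of products of matrix-valued maps *)

Section SecondOrderCalculus.
Context {R : realType}.

(** Needed because formulas for gradients hold only where the maps involved are
    differentiable, that is, on a neighbourhood. *)
Lemma near_eq_diff (V W : normedModType R) (f g : V -> W) (x : V) :
  (\forall y \near x, f y = g y) -> differentiable g x ->
  differentiable f x /\ 'd f x = 'd g x :> (V -> W).
Proof.
move=> fg dg.
have E : f \o shift x = cst (f x) + 'd g x +o_ (0 : V) id.
  apply/eqaddoP => e e0.
  have /eqaddoP/(_ e e0) gP := diff_locally dg.
  have fgx : f x = g x by exact: nbhs_singleton fg.
  have fg0 : \forall h \near (0 : V), f (h + x) = g (h + x).
    by move: fg; rewrite (near_shift 0 x); apply: filterS => h /=; rewrite subr0.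
  near=> h.
  have -> : (f \o shift x - (cst (f x) + 'd g x)) h =
      (g \o shift x - (cst (g x) + 'd g x)) h.
    rewrite !fctE /= fgx; congr (_ - _); by near: h.
  by near: h.
have dgf := diff_unique (diff_continuous dg) E.
split=> //; apply/diff_locallyP; rewrite dgf; split=> //.
exact: diff_continuous.
Unshelve. all: by end_near. Qed.

Lemma diff_mulmx_fun (V : normedModType R) m n k (F : V -> 'M[R]_(m, n))
    (G : V -> 'M[R]_(n, k)) (x : V) :
  differentiable F x -> differentiable G x ->
  differentiable (fun y => F y *m G y) x /\
  forall u, 'd (fun y => F y *m G y) x u = 'd F x u *m G x + F x *m 'd G x u.
Proof.
move=> dF dG.
pose B : {bilinear 'M[R]_(m, n) -> 'M[R]_(n, k) -> 'M[R]_(m, k)} := @mulmx R m n k.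
have Bc : continuous (fun p : 'M[R]_(m, n) * 'M[R]_(n, k) => B p.1 p.2).
  exact: continuous_mulmx.
have dB := differentiable_bilin (F x, G x) Bc.
have dP : differentiable (fun y => (F y, G y)) x by exact: differentiable_pair.
have -> : (fun y => F y *m G y) = (fun p => B p.1 p.2) \o (fun y => (F y, G y)) by [].
split; first exact: differentiable_comp.
move=> u; rewrite diff_comp // diff_bilin // diff_pair //=.
by rewrite addrC.
Qed.

Lemma diff_trmx_fun (V : normedModType R) m n (F : V -> 'M[R]_(m, n)) (x : V) :
  differentiable F x ->
  differentiable (fun y => (F y)^T) x /\
  forall u, 'd (fun y => (F y)^T) x u = ('d F x u)^T.
Proof.
move=> dF.
have tc : continuous (trmx : 'M[R]_(m, n) -> 'M[R]_(n, m)).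
  move=> M; have FM : Filter (nbhs M) by exact: nbhs_filter.
  by apply: (@cvg_trmx _ _ _ FM _ _ id).
have -> : (fun y => (F y)^T) = trmx \o F by [].
have dt : differentiable (trmx : 'M[R]_(m, n) -> 'M[R]_(n, m)) (F x).
  exact: linear_differentiable.
split; first exact: differentiable_comp.
by move=> u; rewrite diff_comp // diff_lin.
Qed.

Lemma diffE_grad n (f : 'rV[R]_n -> R) (x v : 'rV[R]_n) :
  'd f x v = dot (grad f x) v.
Proof.
rewrite dotE {1}[v]row_sum_delta linear_sum /=.
by apply: eq_bigr => i _; rewrite linearZ mxE mulrC.
Qed.

Lemma grad_unique n (f : 'rV[R]_n -> R) (x w : 'rV[R]_n) :
  (forall v, 'd f x v = dot w v) -> grad f x = w.
Proof.
move=> H; apply/rowP => i; rewrite mxE H dotE (bigD1 i) //= mxE !eqxx mulr1.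
by rewrite big1 ?addr0 // => j ji; rewrite mxE (negbTE ji) andbF mulr0.
Qed.

Lemma quad_formE n (H : 'M[R]_n) (d : 'rV[R]_n) : quad_form H d = dot (d *m H) d.
Proof. by rewrite dot_mulmx. Qed.

End SecondOrderCalculus.

(** * Second derivatives of the dissolved objective and of the constraints *)

Section Objective.
Context {R : realType}.

Lemma diff_jacobian_dot n p (c : 'rV[R]_n -> 'rV[R]_p) y (w : 'rV[R]_p) v :
  dot w ('d c y v) = dot (w *m ('J c y)^T) v.
Proof. by rewrite diffE_jacobian dot_mulmx trmxK. Qed.

Lemma grad_cdp_obj n p (f : 'rV[R]_n -> R) (c : 'rV[R]_n -> 'rV[R]_p)
    (A : 'rV[R]_n -> 'rV[R]_n) (beta : R) (y : 'rV[R]_n) :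
  differentiable f (A y) -> differentiable c y -> differentiable A y ->
  grad (cdp_obj f c A beta) y =
    grad f (A y) *m ('J A y)^T + beta *: (c y *m ('J c y)^T).
Proof.
move=> df dc dA; apply: grad_unique => v.
have dfA : differentiable (f \o A) y by exact: differentiable_comp.
have [dct ct] := diff_trmx_fun dc.
have [dcc cc] := diff_mulmx_fun dc dct.
pose ent (M : 'M[R]_1) : R := M 0 0.
have entc : continuous ent by exact: coord_continuous.
have entl : linear ent by move=> a M N; rewrite /ent !mxE.
pose entM := GRing.isLinear.Build _ _ _ _ _ entl.
pose entL : {linear 'M[R]_1 -> R} := HB.pack ent entM.
have de M : differentiable ent M by exact: (@linear_differentiable _ _ _ entL).
have dent M : 'd ent M = ent :> ('M[R]_1 -> R) by exact: (@diff_lin _ _ _ entL).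
pose q z := (c z *m (c z)^T : 'M[R]_1).
have dq : differentiable (ent \o q) y by exact: differentiable_comp.
have -> : cdp_obj f c A beta = (f \o A) + (beta / 2) \*: (ent \o q).
  by apply/funext => z; rewrite /cdp_obj fctE enorm_sqr.
have dz : differentiable ((beta / 2) \*: (ent \o q)) y by exact: differentiableZ.
have E1 : 'd (f \o A) y v = 'd f (A y) ('d A y v).
  exact: (congr1 (fun F => F v) (diff_comp dA df)).
have E2 : 'd (ent \o q) y v = ent ('d q y v).
  rewrite -[RHS](congr1 (fun F => F ('d q y v)) (dent (q y))).
  exact: (congr1 (fun F => F v) (diff_comp dcc (de _))).
rewrite (diffD dfA dz) (diffZ _ dq).
rewrite dotDl dotZl -diff_jacobian_dot -diff_jacobian_dot -diffE_grad -E1.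
rewrite -[LHS]/('d (f \o A) y v + beta / 2 * 'd (ent \o q) y v) E2 cc ct.
congr (_ + _).
rewrite /ent mxE -/(dot _ _) -/(dot _ _) [dot ('d c y v) _]dotC.
by field.
Qed.

Lemma grad_entry n p (c : 'rV[R]_n -> 'rV[R]_p) (y : 'rV[R]_n) i :
  differentiable c y ->
  grad (fun z => c z 0 i) y = delta_mx 0 i *m ('J c y)^T.
Proof.
move=> dc; apply: grad_unique => v.
rewrite -diff_jacobian_dot.
have -> : (fun z => c z 0 i) = (fun N : 'rV[R]_p => N 0 i) \o c by [].
have entc : continuous (fun N : 'rV[R]_p => N 0 i) by exact: coord_continuous.
have entl : linear (fun N : 'rV[R]_p => N 0 i) by move=> a M N; rewrite !mxE.
pose entM := GRing.isLinear.Build _ _ _ _ _ entl.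
pose entL : {linear 'rV[R]_p -> R} := HB.pack (fun N : 'rV[R]_p => N 0 i) entM.
have dent M : 'd (fun N : 'rV[R]_p => N 0 i) M = (fun N : 'rV[R]_p => N 0 i)
    :> ('rV[R]_p -> R) by exact: (@diff_lin _ _ _ entL).
rewrite diff_comp ?dent //; last exact: differentiable_coord.
rewrite /= dotE (bigD1 i) //= mxE !eqxx mul1r big1 ?addr0 // => j ji.
by rewrite mxE (negbTE ji) mul0r.
Qed.

(** Column [i] of the differential of the transposed Jacobian along [d] is the
    derivative along [d] of the gradient of the [i]-th constraint. *)
Lemma quad_form_hess_comb n p (c : 'rV[R]_n -> 'rV[R]_p) (l : 'rV[R]_p)
    (x d : 'rV[R]_n) :
  (\forall y \near x, differentiable c y) -> differentiable (jacobian c) x ->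
  quad_form (hess_comb c l x) d = dot l (d *m 'd (jacobian c) x d).
Proof.
move=> dc dJ; rewrite quad_formE /hess_comb mulmx_sumr dotC dot_sumr dotE.
apply: eq_bigr => i _.
rewrite -scalemxAr dotZr /hess; congr (_ * _); rewrite -diffE_jacobian.
have gE : \forall y \near x,
    grad (fun z => c z 0 i) y = delta_mx 0 i *m ('J c y)^T.
  by apply: filterS dc => y; exact: grad_entry.
have [dt tE] := diff_trmx_fun dJ.
have dcst : differentiable (cst (delta_mx 0 i : 'rV[R]_p)) x by [].
have [dm mE] := diff_mulmx_fun dcst dt.
have [_ ->] := near_eq_diff gE dm.
rewrite mE diff_cst mul0mx add0r tE.
rewrite dotC dot_mulmx trmxK.
rewrite dotE (bigD1 i) //= mxE !eqxx mul1r big1 ?addr0 // => j ji.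
by rewrite mxE (negbTE ji) mul0r.
Qed.

(** In [grad f (A y) *m ('J A y)^T + beta *: (c y *m ('J c y)^T)] the penalty term
    contributes nothing to second order along [d]: each term of its derivative has
    a factor [c x] or [d *m 'J c x], and both vanish.  As [d] is fixed by the
    derivative of [A], the first term leaves the Hessian of [f] and the curvature
    of [A] weighted by the gradient of [f]. *)
Lemma quad_form_hess_cdp_obj n p (f : 'rV[R]_n -> R) (c : 'rV[R]_n -> 'rV[R]_p)
    (A : 'rV[R]_n -> 'rV[R]_n) (beta : R) (x d : 'rV[R]_n) :
  (forall y, differentiable f y) -> (\forall y \near x, differentiable c y) ->
  (\forall y \near x, differentiable A y) ->
  differentiable (grad f) x -> differentiable (jacobian c) x ->
  differentiable (jacobian A) x ->
  c x = 0 -> A x = x -> d *m 'J c x = 0 -> d *m 'J A x = d ->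
  quad_form (hess (cdp_obj f c A beta) x) d =
    quad_form (hess f x) d + dot (grad f x) (d *m 'd (jacobian A) x d).
Proof.
move=> df dc dA dgf dJc dJA cx0 Ax dJ0 dJA1.
have dcx : differentiable c x by exact: nbhs_singleton dc.
have dAx : differentiable A x by exact: nbhs_singleton dA.
have gE : \forall y \near x, grad (cdp_obj f c A beta) y =
    grad f (A y) *m ('J A y)^T + beta *: (c y *m ('J c y)^T).
  near=> y; apply: grad_cdp_obj => //; by near: y.
have [dJAt JAtE] := diff_trmx_fun dJA.
have [dJct JctE] := diff_trmx_fun dJc.
have dgfA : differentiable (grad f \o A) x.
  by apply: differentiable_comp => //; rewrite Ax.
have [d1 E1] := diff_mulmx_fun dgfA dJAt.
have [d2 E2] := diff_mulmx_fun dcx dJct.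
have d2' : differentiable (beta \*: (fun y => c y *m ('J c y)^T)) x.
  exact: differentiableZ.
have dsum : differentiable ((fun y => (grad f \o A) y *m ('J A y)^T) +
    beta \*: (fun y => c y *m ('J c y)^T)) x by exact: differentiableD.
have [_ E] := near_eq_diff gE dsum.
pose H := 'd (jacobian A) x d.
have HV : d *m hess (cdp_obj f c A beta) x =
    d *m hess f x *m ('J A x)^T + grad f x *m H^T.
  apply: (etrans (esym (diffE_jacobian _ _ _))).
  apply: (etrans (congr1 (fun F => F d) E)).
  apply: (etrans (congr1 (fun F => F d) (diffD d1 d2'))).
  apply: (etrans (congr1 (fun F => 'd _ x d + F d) (diffZ beta d2))).
  rewrite E1.
  apply: (etrans (congr1 (fun w => _ + beta *: w) (E2 d))).
  rewrite JAtE JctE cx0 mul0mx addr0 (diffE_jacobian c) dJ0 mul0mx scaler0 addr0.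
  have gA : (grad f \o A) x = grad f x by rewrite /= Ax.
  rewrite gA; congr (_ + _); congr (_ *m _).
  have dgfAx : differentiable (grad f) (A x) by rewrite Ax.
  apply: (etrans (congr1 (fun F => F d) (diff_comp dAx dgfAx))).
  have AD : 'd A x d = d by rewrite diffE_jacobian.
  have gAx : 'd (grad f) (A x) = 'd (grad f) x :> ('rV[R]_n -> 'rV[R]_n).
    exact: (congr1 (fun z => ('d (grad f) z : 'rV[R]_n -> 'rV[R]_n)) Ax).
  apply: (etrans (congr1 ('d (grad f) (A x)) AD)).
  by apply: (etrans (congr1 (fun F => F d) gAx)); exact: diffE_jacobian.
apply: (etrans (quad_formE _ _)); apply: (etrans (congr1 (fun w => dot w d) HV)).
have gen (Hf M N : 'M[R]_n) (g : 'rV[R]_n) : d *m M = d ->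
    dot (d *m Hf *m M^T + g *m N^T) d = quad_form Hf d + dot g (d *m N).
  by move=> dM; rewrite dotDl !dot_mulmx !trmxK dM -dot_mulmx quad_formE.
exact: (gen _ _ _ _ dJA1).
Unshelve. all: by end_near. Qed.

End Objective.

(** * Tangent cones and projections for convex sets *)

Section Tangent.
Context {R : realType} {n : nat}.
Implicit Types (S : set 'rV[R]_n) (x y z d e : 'rV[R]_n).

Lemma convex_segmentP S :
  convex_set S <->
  (forall y z (s : R), S y -> S z -> 0 <= s <= 1 -> S (y + s *: (z - y))).
Proof.
split=> [cS y z s Sy Sz /andP[s0 s1]|cS y z l].
  have := cS z y (Itv01 s0 s1).
  rewrite !inE => /(_ Sz Sy); congr S; rewrite /conv /=.
  by rewrite scalerBr addrCA -{2}[y]scale1r -scalerBl.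
rewrite !inE => Sy Sz.
have := cS z y l%:num Sz Sy; rewrite ge0 le1 => /(_ isT); congr S.
by rewrite /conv /= scalerBr addrCA -{1}[z]scale1r -scalerBl.
Qed.

Lemma convex_shrink S x e (r s : R) : convex_set S -> S x ->
  0 <= s <= r -> S (x + r *: e) -> S (x + s *: e).
Proof.
move=> /convex_segmentP cS Sx /andP[s0]; rewrite le_eqVlt => /predU1P[->//|sr Sr].
have r0 : 0 < r by exact: le_lt_trans sr.
have := cS _ _ (s / r) Sx Sr.
rewrite [X in _ *: X]addrAC subrr add0r scalerA divfK ?gt_eqF //; apply.
by rewrite divr_ge0 ?(ltW r0) //= ler_pdivrMr // mul1r ltW.
Qed.

(** By convexity a feasible step can be shortened, so it is enough to have one
    step per accuracy; the sequence in the definition is then obtained by taking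
    accuracy and step at most [k.+1%:R^-1]. *)
Lemma tangent_coneP S x d : convex_set S -> S x ->
  tangent_cone S x d <->
  (forall eps : R, 0 < eps -> exists2 r : R, 0 < r &
     exists2 e, `|e - d| <= eps & S (x + r *: e)).
Proof.
move=> cS Sx; split=> [[t [e [t0 tt ee tS]]] eps eps0|H].
  have [N _ /(_ N (leqnn N)) hN] : \forall k \near \oo, `|e k - d| <= eps.
    by near do rewrite distrC; apply: (cvgr_dist_le _ _ ee).
  by exists (t N) => //; exists (e N).
have H' k : exists te : R * 'rV[R]_n,
    [/\ 0 < te.1 <= k.+1%:R^-1, `|te.2 - d| <= k.+1%:R^-1
      & S (x + te.1 *: te.2)].
  have k0 : (0 : R) < k.+1%:R^-1 by rewrite invr_gt0.
  have [r r0 [e ed Se]] := H _ k0.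
  exists (Num.min r k.+1%:R^-1, e) => /=; split=> //.
    by rewrite lt_min r0 k0 /= ge_min lexx orbT.
  apply: convex_shrink Se => //.
  by rewrite le_min (ltW r0) (ltW k0) /= ge_min lexx.
have [te teP] := choice H'.
exists (fun k => (te k).1), (fun k => (te k).2); split.
- by move=> k; have [/andP[]] := teP k.
- apply: (@squeeze_cvgr _ _ _ _ (cst 0) (@harmonic R)).
  + by apply: nearW => k; have [/andP[/ltW h1 h2] _ _] := teP k; rewrite h1.
  + exact: cvg_cst.
  + exact: cvg_harmonic.
- apply/cvgrPdist_le => eps eps0.
  move/cvgrPdist_le: (@cvg_harmonic R) => /(_ _ eps0).
  apply: filterS => k; rewrite sub0r normrN /harmonic ger0_norm ?invr_ge0 // => hk.
  by rewrite distrC; have [_ h _] := teP k; exact: le_trans h hk.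
- by move=> k; have [] := teP k.
Unshelve. all: by end_near. Qed.

(** Every sufficiently short step works, so that one step length can serve
    finitely many directions at once. *)
Lemma tangent_cone_near S x d : convex_set S -> S x -> tangent_cone S x d ->
  forall eps : R, 0 < eps -> exists2 r0 : R, 0 < r0 &
    forall r, 0 <= r <= r0 -> exists2 z, S z & `|z - x - r *: d| <= eps * r.
Proof.
move=> cS Sx /(tangent_coneP d cS Sx) H eps eps0.
have [r0 r00 [e ed Se]] := H _ eps0; exists r0 => // r /andP[r1 r2].
exists (x + r *: e); first by apply: (convex_shrink cS Sx _ Se); rewrite r1.
by rewrite [x + _ - x]addrAC subrr add0r -scalerBr normrZ ger0_norm // mulrC ler_wpM2r.
Qed.

Lemma tangent_cone_feasible S x y : convex_set S -> S x -> S y ->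
  tangent_cone S x (y - x).
Proof.
move=> cS Sx Sy; apply/tangent_coneP => // eps eps0; exists 1 => //.
by exists (y - x); rewrite ?subrr ?normr0 ?ltW // scale1r addrCA subrr addr0.
Qed.

Lemma tangent_cone0 S x : S x -> convex_set S -> tangent_cone S x 0.
Proof.
by move=> Sx cS; rewrite -(subrr x); exact: tangent_cone_feasible.
Qed.

Lemma tangent_coneZ S x d (a : R) : convex_set S -> S x -> 0 <= a ->
  tangent_cone S x d -> tangent_cone S x (a *: d).
Proof.
move=> cS Sx; rewrite le_eqVlt => /predU1P[<- _|a0 Td].
  by rewrite scale0r; exact: tangent_cone0.
apply/tangent_coneP => // eps eps0.
have /(tangent_coneP d cS Sx) H := Td.
have [r r0 [e ed Se]] := H _ (divr_gt0 eps0 a0).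
exists (r / a); first exact: divr_gt0.
exists (a *: e); last by rewrite scalerA divfK ?gt_eqF.
by rewrite -scalerBr normrZ gtr0_norm // mulrC -ler_pdivlMr.
Qed.

(** The midpoint of the two feasible points reached along [d1] and [d2] is reached
    along [d1 + d2] with half the step. *)
Lemma tangent_coneD S x d1 d2 : convex_set S -> S x ->
  tangent_cone S x d1 -> tangent_cone S x d2 -> tangent_cone S x (d1 + d2).
Proof.
move=> cS Sx /(tangent_coneP d1 cS Sx) H1 /(tangent_coneP d2 cS Sx) H2.
apply/tangent_coneP => // eps eps0.
have e20 : 0 < eps / 2 by rewrite divr_gt0.
have [r1 r10 [e1 ed1 Se1]] := H1 _ e20.
have [r2 r20 [e2 ed2 Se2]] := H2 _ e20.
pose r := Num.min r1 r2.
have r0 : 0 < r by rewrite lt_min r10.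
exists (r / 2); first by rewrite divr_gt0.
exists (e1 + e2).
  rewrite opprD addrACA (le_trans (ler_normD _ _)) // [leRHS]splitr lerD //.
have S1 : S (x + r *: e1).
  by apply: (convex_shrink cS Sx _ Se1); rewrite ltW //= ge_min lexx.
have S2 : S (x + r *: e2).
  by apply: (convex_shrink cS Sx _ Se2); rewrite ltW //= ge_min lexx orbT.
have /convex_segmentP := cS => /(_ _ _ 2^-1 S1 S2).
have h : ((0 : R) <= 2^-1) && ((2^-1 : R) <= 1).
  by rewrite invr_ge0 ler0n invf_le1 ?ler1n ?ltr0n.
move=> /(_ h); congr S.
apply/rowP => j; rewrite !mxE; field => //.
Qed.

Lemma tangent_cone_mono S S' x : S `<=` S' ->
  tangent_cone S x `<=` tangent_cone S' x.
Proof.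
move=> SS d [t [e [t0 tt ee tS]]]; exists t, e; split=> // k.
exact/SS/tS.
Qed.

Lemma tangent_cone_sum S x (I : Type) (s : seq I) (F : I -> 'rV[R]_n) :
  convex_set S -> S x -> (forall i, tangent_cone S x (F i)) ->
  tangent_cone S x (\sum_(i <- s) F i).
Proof.
move=> cS Sx HF; elim/big_rec: _ => [|i y _]; first exact: tangent_cone0.
exact: tangent_coneD.
Qed.

Lemma bounded_ball_compact S x (M : R) : closed S ->
  (forall z, S z -> `|z - x| <= M) -> compact S.
Proof.
move=> Scl SM; apply: bounded_closed_compact => //.
exists (M + `|x|); split; first exact: num_real.
move=> r /ltW Mr z Sz /=; apply: le_trans Mr.
by rewrite -[z](subrK x) (le_trans (ler_normD _ _)) // lerD2r SM.
Qed.

(** The minimiser [y] of the distance to [w] exists by compactness; if some [z]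
    violated the inequality, a short move from [y] to [z] would reduce the
    distance. *)
Lemma projection_convex S w x : closed S -> convex_set S -> S x ->
  exists2 y, S y & forall z, S z -> dot (w - y) (z - y) <= 0.
Proof.
move=> Scl cS Sx.
pose q z := dot (z - w) (z - w).
have qc : continuous q.
  have zw : continuous (fun y : 'rV[R]_n => y - w).
    move=> z; apply: continuousB; [exact: (fun _ => id)|exact: cst_continuous].
  by move=> z; exact: (cvg_dot (zw z) (zw z)).
pose A := S `&` [set z | q z <= q x].
have Acl : closed A.
  apply: closedI => //.
  apply: (@preimage_closed _ _ q [set u | u <= q x]) => //; exact: closed_le.
have cA : compact A.
  apply: (@bounded_ball_compact _ w (enorm (x - w))) => // z [_ /= qz].
  by rewrite (le_trans (ler_norm_enorm _)) // ler_wsqrtr.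
have [|||y] := @EVT_min_rV R n q A.
- by exists x; split=> /=.
- exact: cA.
- exact: continuous_subspaceT.
rewrite inE => -[Sy yx] ymin; exists y => // z Sz.
have qmin u : S u -> q y <= q u.
  move=> Su; have [ux|/ltW xu] := leP (q u) (q x).
    by apply: ymin; rewrite inE; split.
  exact: le_trans xu.
rewrite leNgt; apply/negP => pos.
pose a := dot (w - y) (z - y); pose b := dot (z - y) (z - y).
have b0 : 0 <= b := dot_ge0 _.
(* the squared distance at step s is q y - 2 s a + s ^+ 2 b *)
pose s := a / (a + b).
have a0 : 0 < a := pos.
have ab0 : 0 < a + b by rewrite ltr_wpDr.
have s01 : 0 <= s <= 1.
  by rewrite /s divr_ge0 ?(ltW a0) ?(ltW ab0) //= ler_pdivrMr // mul1r lerDl.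
have /convex_segmentP /(_ y z s Sy Sz s01) Su := cS.
have := qmin _ Su.
have -> : q (y + s *: (z - y)) = q y - 2 * s * a + s ^+ 2 * b.
  have -> : q (y + s *: (z - y)) =
      dot ((y - w) + s *: (z - y)) ((y - w) + s *: (z - y)).
    by rewrite /q addrAC.
  rewrite /q /a /b -[w - y]opprB dotNl; move: (y - w) (z - y) => p u.
  by rewrite dotDl !dotDr !dotZl !dotZr [dot u p]dotC; ring.
have s0 : 0 < s by rewrite divr_gt0.
have sab : s * (a + b) = a by rewrite divfK ?gt_eqF.
have : 0 < s * a by rewrite mulr_gt0.
have : s ^+ 2 * b = s * (s * (a + b)) - s ^+ 2 * a by ring.
rewrite sab.
have : 0 <= s ^+ 2 * a by rewrite mulr_ge0 ?sqr_ge0 ?ltW.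
lra.
Qed.

End Tangent.

(** * Affine hulls and their directions *)

Section AffineHull.
Context {R : realType} {n : nat}.
Implicit Types (X S : set 'rV[R]_n) (x y z d e : 'rV[R]_n).

Lemma subset_affine_hull X : X `<=` affine_hull X.
Proof.
move=> y Xy; exists 1%N, (fun=> 1), (fun=> y); split=> //.
  by rewrite big_ord1.
by rewrite big_ord1 scale1r.
Qed.

Lemma affine_hull_line X y z (s : R) : affine_hull X y -> affine_hull X z ->
  affine_hull X (y + s *: (z - y)).
Proof.
move=> [k [a [u [Xu a1 ->]]]] [l [b [v [Xv b1 ->]]]].
exists (k + l)%N, (fun i => match fintype.split i with
                     | inl i => (1 - s) * a i | inr j => s * b j end),
  (fun i => match fintype.split i with inl i => u i | inr j => v j end).
split.
- by move=> i; case: (fintype.split i).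
- rewrite big_split_ord /=.
  under eq_bigr => i _ do rewrite (unsplitK (inl i : 'I_k + 'I_l)).
  under [X in _ + X]eq_bigr => i _ do rewrite (unsplitK (inr i : 'I_k + 'I_l)).
  by rewrite -!mulr_sumr a1 b1 !mulr1 subrK.
- rewrite big_split_ord /=.
  under [X in _ = X + _]eq_bigr => i _ do rewrite (unsplitK (inl i : 'I_k + 'I_l)).
  under [X in _ = _ + X]eq_bigr => i _ do rewrite (unsplitK (inr i : 'I_k + 'I_l)).
  under [X in _ = X + _]eq_bigr => i _ do rewrite -scalerA.
  under [X in _ = _ + X]eq_bigr => i _ do rewrite -scalerA.
  rewrite -!scaler_sumr; move: (\sum_(i < k) _) (\sum_(i < l) _) => p q.
  by apply/rowP => j; rewrite !mxE; ring.
Qed.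

Lemma convex_affine_hull X : convex_set (affine_hull X).
Proof. by apply/convex_segmentP => y z s Xy Xz _; exact: affine_hull_line. Qed.

Lemma direction_affine_hull X x y : direction X x (y - x) <-> affine_hull X y.
Proof.
split=> [[z Xz /(congr1 (+%R^~ x))]|Xy]; last by exists y.
by rewrite !subrK => <-.
Qed.

Lemma directionZ X x d (a : R) : X x -> direction X x d -> direction X x (a *: d).
Proof.
move=> /subset_affine_hull Xx [y Xy <-].
rewrite -[_ *: _](addrK x) direction_affine_hull addrC.
exact: affine_hull_line.
Qed.

Lemma directionD X x d e : X x -> direction X x d -> direction X x e ->
  direction X x (d + e).
Proof.
move=> Xx [y Xy <-] [z Xz <-].
have -> : y - x + (z - x) = 2 *: ((y + 2^-1 *: (z - y)) - x).
  by apply/rowP => j; rewrite !mxE; field.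
apply: directionZ => //; apply/direction_affine_hull.
exact: affine_hull_line.
Qed.

Lemma direction0 X x : X x -> direction X x 0.
Proof. by move=> Xx; exists x; [exact: subset_affine_hull | rewrite subrr]. Qed.

Lemma direction_mulmx X x m (a : 'rV[R]_m) (K : 'M[R]_(m, n)) : X x ->
  (forall i, direction X x (row i K)) -> direction X x (a *m K).
Proof.
move=> Xx XK; rewrite mulmx_sum_row; elim/big_rec: _ => [|i e _].
  exact: direction0.
by apply: directionD => //; exact: directionZ.
Qed.

(** A matrix of maximal rank among those with rows in the direction space already
    spans it.  Closedness of the affine hull is read off from this description. *)
Lemma direction_rowspace X x : X x ->
  exists B : 'M[R]_n, forall d, direction X x d <-> (d <= B)%MS.
Proof.
move=> Xx.
pose P k := `[< exists B : 'M[R]_n,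
  (forall i, direction X x (row i B)) /\ \rank B = k >].
have P0 : exists k, P k.
  exists 0%N; apply/asboolP; exists 0; split; last by rewrite mxrank0.
  by move=> i; rewrite row0; exact: direction0.
have Pn k : P k -> (k <= n)%N.
  by move=> /asboolP[B [_ <-]]; exact: rank_leq_row.
case: (ex_maxnP P0 Pn) => k /asboolP[B [XB rB]] kmax.
exists B => d; split=> [Xd|/submxP[a ->]]; last exact: direction_mulmx.
have XBd : forall i, direction X x (row i (B + d)%MS).
  move=> i.
  have /sub_addsmxP[[u v] ->] : (row i (B + d)%MS <= B + d)%MS by exact: row_sub.
  apply: directionD => //; apply: direction_mulmx => //= j.
  by rewrite row_id.
have := kmax (\rank (B + d)%MS).
have -> : P (\rank (B + d)%MS) by apply/asboolP; exists (B + d)%MS.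
move=> /(_ isT) le.
have BBd : (B <= B + d)%MS by exact: addsmxSl.
have : (B + d <= B)%MS.
  by have := mxrank_leqif_sup BBd; rewrite /leqif rB => -[h <-]; rewrite eqn_leq h.
by apply: submx_trans; exact: addsmxSr.
Qed.

(** The row space of [B] is the kernel of the continuous map [mulmxr (cokermx B)]. *)
Lemma closed_rowspace m (B : 'M[R]_(m, n)) : closed [set d : 'rV[R]_n | (d <= B)%MS].
Proof.
have -> : [set d : 'rV[R]_n | (d <= B)%MS] =
    (fun d => `|d *m cokermx B|) @^-1` [set u : R | u <= 0].
  apply/seteqP; split=> d /=; rewrite submxE.
    by move=> /eqP ->; rewrite normr0.
  by rewrite normr_le0.
apply: preimage_closed; last exact: closed_le.
move=> d _.
exact: (cvg_norm (@mulmxr_continuous _ _ _ _ (cokermx B) d)).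
Qed.

Lemma closed_direction X x : X x -> closed (direction X x).
Proof.
move=> Xx; have [B BP] := direction_rowspace Xx.
have -> : direction X x = [set d : 'rV[R]_n | (d <= B)%MS].
  by apply/seteqP; split=> d /BP.
exact: closed_rowspace.
Qed.

Lemma closed_affine_hull X x : X x -> closed (affine_hull X).
Proof.
move=> Xx.
have -> : affine_hull X = (fun y : 'rV[R]_n => y - x) @^-1` direction X x.
  by apply/seteqP; split=> y /direction_affine_hull; exact.
apply: preimage_closed; last exact: closed_direction.
move=> y _; apply: continuousB; [exact: (fun _ => id)|exact: cst_continuous].
Qed.

(** Tangent vectors are limits of directions between points of [X], and the
    direction space is closed. *)
Lemma tangent_cone_direction X x : X x -> tangent_cone X x `<=` direction X x.
Proof.
move=> Xx d [t [e [t0 tt ee tS]]].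
apply: (closed_cvg _ (closed_direction Xx) _ _ ee).
apply: nearW => k.
have -> : e k = (t k)^-1 *: (x + t k *: e k - x).
  by rewrite addrAC subrr add0r scalerA mulVf ?scale1r // gt_eqF.
apply: directionZ => //; apply/direction_affine_hull.
exact/subset_affine_hull/tS.
Qed.

End AffineHull.

(** * An error bound of Robinson type *)

Section ErrorBound.
Context {R : realType}.

(** Residuals are measured by the sum of absolute values: moving a single nonzero
    entry towards zero lowers this norm at unit speed whatever the other entries
    are.  Hence the finitely many signed unit vectors are enough as descent
    directions. *)
Definition norm1 {r} (v : 'rV[R]_r) : R := \sum_i `|v 0 i|.

Lemma norm1_ge0 r (v : 'rV[R]_r) : 0 <= norm1 v.
Proof. by apply: sumr_ge0. Qed.

Lemma ler_norm1D r (u v : 'rV[R]_r) : norm1 (u + v) <= norm1 u + norm1 v.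
Proof.
by rewrite -big_split ler_sum // => i _; rewrite mxE ler_normD.
Qed.

Lemma norm1Z r (a : R) (v : 'rV[R]_r) : norm1 (a *: v) = `|a| * norm1 v.
Proof. by rewrite mulr_sumr; apply: eq_bigr => i _; rewrite mxE normrM. Qed.

Lemma ler_norm1_norm r (v : 'rV[R]_r) : norm1 v <= r%:R * `|v|.
Proof.
apply: (@le_trans _ _ (\sum_(i < r) `|v|)).
  by apply: ler_sum => i _; exact: ler_mx_entry.
by rewrite sumr_const card_ord -[leLHS]mulr_natl.
Qed.

(** The exponent [0 <= u 0 i] of [-1] produces the sign opposite to that of
    [u 0 i]. *)
Lemma norm1_shift_entry r (u : 'rV[R]_r) i (a : R) : 0 <= a <= `|u 0 i| ->
  norm1 (u + a *: ((-1) ^+ (0 <= u 0 i)%R *: delta_mx 0 i)) = norm1 u - a.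
Proof.
move=> /andP[a0 au]; rewrite /norm1 (bigD1 i) //= [in RHS](bigD1 i) //=.
rewrite addrAC; congr (_ + _); last first.
  by apply: eq_bigr => j /negbTE ji; rewrite !mxE ji andbF !mulr0 addr0.
rewrite !mxE !eqxx mulr1; move: au; case: (leP 0 (u 0 i)) => [u0|u0] au.
  by rewrite expr1 mulrN1 ger0_norm ?subr_ge0 //; move: au; rewrite ger0_norm.
rewrite expr0 mulr1 in au *; rewrite (ltr0_norm u0) in au *.
by rewrite ler0_norm; lra.
Qed.


(** Since [row i K *m J0] is a unit vector, a feasible step along the tangent
    direction [row i K], or its opposite, moves the linearised residual along one
    coordinate; one step length [rho] serves all coordinates and signs. *)
Lemma tangent_common_step n r (S : set 'rV[R]_n) (x : 'rV[R]_n)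
    (K : 'M[R]_(r, n)) (J0 : 'M[R]_(n, r)) (eps : R) :
  convex_set S -> S x ->
  (forall i (b : bool), tangent_cone S x ((-1) ^+ b *: row i K)) ->
  K *m J0 = 1%:M -> 0 < eps ->
  exists2 rho : R, 0 < rho <= 1 & forall i (b : bool), exists2 z, S z &
    `|z - x| <= `|K| + 1 /\
    norm1 ((z - x) *m J0 - rho *: ((-1) ^+ b *: delta_mx 0 i)) <= eps * rho.
Proof.
move=> cS Sx TK KJ eps0.
pose c : R := r%:R * n%:R * `|J0| + 1.
have c0 : 0 < c by rewrite ltr_wpDl // !mulr_ge0.
pose e := Num.min 1 (eps / c).
have e0 : 0 < e by rewrite lt_min ltr01 divr_gt0.
have step (ib : 'I_r * bool) : exists r0 : R, 0 < r0 /\ forall rho, 0 <= rho <= r0 ->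
    exists2 z, S z & `|z - x - rho *: ((-1) ^+ ib.2 *: row ib.1 K)| <= e * rho.
  by have [r0 r00 H] := tangent_cone_near cS Sx (TK ib.1 ib.2) e0; exists r0.
have [f fP] := choice step.
have [rho [rho0 rho1 rhof]] :
    exists rho : R, [/\ 0 < rho, rho <= 1 & forall ib, rho <= f ib].
  near (0 : R)^'+ => rho; exists rho; split.
  - by near: rho; exact: nbhs_right_gt.
  - by near: rho; exact: nbhs_right_le.
  - near: rho; apply: filter_forall => ib; apply: nbhs_right_le.
    by have [] := fP ib.
exists rho; first by rewrite rho0.
move=> i b; have [_ /(_ rho)] := fP (i, b).
rewrite (ltW rho0) rhof => /(_ isT)[z Sz /= zrho]; exists z => //.
set k := (-1) ^+ b *: row i K in zrho.
have kK : `|k| <= `|K|.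
  rewrite normrZ normrX normrN1 expr1n mul1r; apply: mx_norm_le => // a j.
  by rewrite mxE ler_mx_entry.
have eps1 : e * rho <= 1.
  by rewrite mulr_ile1 ?(ltW e0) ?(ltW rho0) // /e ge_min lexx.
split.
  rewrite -[z - x](subrK (rho *: k)) addrC (le_trans (ler_normD _ _)) //.
  rewrite lerD ?(le_trans zrho) // normrZ gtr0_norm //.
  by rewrite (le_trans _ kK) // ler_piMl.
have -> : (-1) ^+ b *: delta_mx 0 i = k *m J0.
  by rewrite /k -scalemxAl -row_mul KJ row1.
rewrite scalemxAl -mulmxBl (le_trans (ler_norm1_norm _)) //.
apply: (@le_trans _ _ (r%:R * (n%:R * (e * rho) * `|J0|))).
  rewrite ler_wpM2l // (le_trans (ler_norm_mulmx _ _)) //.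
  by rewrite ler_wpM2r // ler_wpM2l.
have -> : r%:R * (n%:R * (e * rho) * `|J0|) = (r%:R * n%:R * `|J0|) * e * rho.
  by ring.
rewrite ler_wpM2r ?(ltW rho0) //.
apply: (@le_trans _ _ (c * e)); first by rewrite ler_wpM2r ?(ltW e0) // lerDl.
by rewrite mulrC -ler_pdivlMr // /e ge_min lexx orbT.
Unshelve. all: by end_near. Qed.

(** [J] stands for the transposed Jacobian of [g].  Keeping it as a parameter makes
    the notion stable under composition with a fixed matrix, [J] being multiplied
    by that matrix. *)
Definition smooth_on_ball {n r} (g : 'rV[R]_n -> 'rV[R]_r)
    (J : 'rV[R]_n -> 'M[R]_(n, r)) (x : 'rV[R]_n) (r0 C : R) : Prop :=
  [/\ forall y, `|y - x| < r0 -> {for y, continuous g},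
      forall y z, `|y - x| < r0 -> `|z - x| < r0 ->
        `|g z - g y - (z - y) *m J y| <= C * `|z - y| ^+ 2
    & forall y z, `|y - x| < r0 -> `|z - x| < r0 ->
        `|J y - J z| <= C * `|y - z|].

(** At [y] close to [x] with nonzero residual, pick a nonzero entry of [g y] and
    the point [z] of [S] whose displacement from [x] corrects that entry to first
    order.  By convexity [z - y] is a feasible direction at [y], and it still
    decreases the residual because [y] and [J y] are close to [x] and [J x]. *)
Lemma robinson_descent n r (S : set 'rV[R]_n) (x : 'rV[R]_n)
    (g : 'rV[R]_n -> 'rV[R]_r) (J : 'rV[R]_n -> 'M[R]_(n, r))
    (K : 'M[R]_(r, n)) (r0 C : R) :
  convex_set S -> S x -> 0 < r0 -> 0 <= C -> smooth_on_ball g J x r0 C ->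
  (forall i (b : bool), tangent_cone S x ((-1) ^+ b *: row i K)) ->
  K *m J x = 1%:M ->
  exists rho M r1 : R, [/\ 0 < rho, 0 < M, 0 < r1 < r0 &
    forall y, S y -> `|y - x| < r1 -> g y != 0 ->
      exists2 w, `|w| <= M & exists2 t : R, 0 < t &
        [/\ S (y + t *: w), `|y + t *: w - x| < r1 &
          norm1 (g (y + t *: w)) <= norm1 (g y) - t * rho]].
Proof.
move=> cS Sx r00 C0 [_ gT JL] TK KJ.
have e80 : (0 : R) < 8^-1 by rewrite invr_gt0.
have [rho /andP[rho0 rho1] step] := tangent_common_step cS Sx TK KJ e80.
pose N : R := n%:R; pose p : R := r%:R; pose j0 := `|J x|; pose M0 := `|K| + 1.
have N0 : 0 <= N by [].
have p0 : 0 <= p by [].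
have j00 : 0 <= j0 by exact: normr_ge0.
have M00 : 0 < M0 by rewrite ltr_wpDl.
pose c1 := p * (N * (M0 * C + j0 + C)) + 1.
have c10 : 0 < c1.
  by rewrite ltr_wpDl // !mulr_ge0 // !addr_ge0 // mulr_ge0 // ltW.
have [r1 [r10 r11 r1r0 r1c]] :
    exists r1 : R, [/\ 0 < r1, r1 <= 1, r1 < r0 & r1 <= rho / 8 / c1].
  near (0 : R)^'+ => r1; exists r1; split; near: r1.
  - exact: nbhs_right_gt.
  - exact: nbhs_right_le.
  - exact: nbhs_right_lt.
  - by apply: nbhs_right_le; rewrite !divr_gt0.
exists (rho / 2), (M0 + 1), r1; split; [exact: divr_gt0|exact: addr_gt0|by rewrite r10|].
move=> y Sy yr1 gy0.
have yr0 : `|y - x| < r0 by exact: lt_trans r1r0.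
have xr0 : `|x - x| < r0 by rewrite subrr normr0.
have [i ui0] : exists i, g y 0 i != 0.
  by apply/rV0Pn.
have [z Sz [zM zE]] := step i (0 <= g y 0 i).
set sg := (-1) ^+ _ *: delta_mx 0 i in zE.
pose w := z - y.
have wM : `|w| <= M0 + 1.
  rewrite /w -(subrKA x) -[M0 + 1]/(`|K| + 1 + 1) (le_trans (ler_normD _ _)) //.
  by rewrite lerD // distrC (le_trans (ltW yr1)).
exists w => //.
have wJ : norm1 (w *m J y - rho *: sg) <= rho / 4.
  have -> : w *m J y - rho *: sg =
     ((z - x) *m J x - rho *: sg) + ((z - x) *m (J y - J x) + (x - y) *m J y).
    have -> : w *m J y = (z - x) *m J y + (x - y) *m J y.
      by rewrite -mulmxDl /w addrA subrK.
    rewrite mulmxBr; move: (_ *m J y) (_ *m J y) (_ *m J x) (sg) => a b c d.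
    by apply/rowP => j; rewrite !mxE; ring.
  rewrite (le_trans (ler_norm1D _ _)) //.
  (* half of the budget pays for the choice of z, half for moving from x to y *)
  have -> : rho / 4 = 8^-1 * rho + rho / 8 by field.
  rewrite lerD // (le_trans (ler_norm1_norm _)) //.
  apply: (@le_trans _ _ (c1 * r1)); last first.
    by rewrite mulrC -ler_pdivlMr.
  apply: (@le_trans _ _ (p * (N * (M0 * C + j0 + C)) * r1)); last first.
    by rewrite ler_wpM2r ?(ltW r10) // lerDl.
  rewrite -mulrA ler_wpM2l // (le_trans (ler_normD _ _)) //.
  have -> : N * (M0 * C + j0 + C) * r1 = N * M0 * (C * r1) + N * r1 * (j0 + C).
    by ring.
  have JyJx : `|J y - J x| <= C * r1.
    by rewrite (le_trans (JL y x yr0 xr0)) // ler_wpM2l // ltW.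
  rewrite lerD // (le_trans (ler_norm_mulmx _ _)) //.
    by rewrite ler_pM // ?mulr_ge0 // ler_wpM2l.
  rewrite ler_pM // ?mulr_ge0 //.
    by rewrite ler_wpM2l // distrC ltW.
  rewrite -[J y](subrK (J x)) addrC (le_trans (ler_normD _ _)) // lerD //.
  by rewrite (le_trans JyJx) // ler_piMr.
have M10 : 0 < M0 + 1 by rewrite addr_gt0.
pose c2 := p * C * (M0 + 1) ^+ 2 + 1.
have c20 : 0 < c2.
  by rewrite ltr_wpDl // mulr_ge0 ?sqr_ge0 // mulr_ge0.
have [t [t0 t1 tM tu tc]] : exists t : R, [/\ 0 < t, t <= 1,
    t < (r1 - `|y - x|) / (M0 + 1), t <= `|g y 0 i| / rho & t <= rho / 4 / c2].
  near (0 : R)^'+ => t; exists t; split; near: t.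
  - exact: nbhs_right_gt.
  - exact: nbhs_right_le.
  - by apply: nbhs_right_lt; rewrite divr_gt0 // subr_gt0.
  - by apply: nbhs_right_le; rewrite divr_gt0 // normr_gt0.
  - by apply: nbhs_right_le; rewrite !divr_gt0.
have twx : `|y + t *: w - x| < r1.
  rewrite addrAC (le_lt_trans (ler_normD _ _)) // normrZ gtr0_norm //.
  rewrite -ltrBrDl; apply: le_lt_trans (_ : t * (M0 + 1) < _).
    by rewrite ler_wpM2l // ltW.
  by rewrite -ltr_pdivlMr.
exists t => //; split=> //.
  have /convex_segmentP cS' := cS.
  by apply: cS' => //; rewrite ltW.
have := gT y (y + t *: w) yr0 (lt_trans twx r1r0).
rewrite [y + _]addrC addrK [t *: w + y]addrC => gE.
set g' := g (y + t *: w) in gE *.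
have -> : g' = (g y + (t * rho) *: sg) + (t *: (w *m J y - rho *: sg)
    + (g' - g y - t *: w *m J y)).
  rewrite -scalemxAl; move: (g') (g y) (w *m J y) (sg) => a b c d.
  by apply/rowP => j; rewrite !mxE; ring.
rewrite (le_trans (ler_norm1D _ _)) //.
rewrite norm1_shift_entry; last first.
  by rewrite mulr_ge0 ?(ltW t0) ?(ltW rho0) //= -ler_pdivlMr.
(* of the gain t * rho, a quarter is lost to the inexact direction and a
   quarter to the second order remainder *)
have -> : norm1 (g y) - t * (rho / 2) =
  norm1 (g y) - t * rho + (t * (rho / 4) + t * (rho / 4)) by field.
rewrite lerD2l (le_trans (ler_norm1D _ _)) // lerD //.
  by rewrite norm1Z gtr0_norm // ler_wpM2l // ltW.
rewrite (le_trans (ler_norm1_norm _)) //.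
apply: (@le_trans _ _ (p * (C * (t * (M0 + 1)) ^+ 2))).
  rewrite ler_wpM2l // (le_trans gE) // ler_wpM2l //.
  rewrite lerXn2r ?nnegrE ?mulr_ge0 ?(ltW t0) ?(ltW M10) //.
  by rewrite normrZ gtr0_norm // ler_wpM2l // ltW.
have -> : p * (C * (t * (M0 + 1)) ^+ 2) = t * (p * C * (M0 + 1) ^+ 2 * t).
  by ring.
rewrite ler_wpM2l ?(ltW t0) //.
apply: (@le_trans _ _ (c2 * t)); first by rewrite ler_wpM2r ?(ltW t0) // lerDl.
by rewrite mulrC -ler_pdivlMr.
Unshelve. all: by end_near. Qed.

Lemma cvg_norm1 r (v : 'rV[R]_r) : {for v, continuous (@norm1 r)}.
Proof.
have FF : Filter (nbhs v) by exact: nbhs_filter.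
apply/(@cvgrPdist_le _ _ _ _ FF) => e e0.
have c0 : 0 < e / (r%:R + 1) by rewrite divr_gt0 // ltr_wpDl.
near=> u.
have uv : `|v - u| <= e / (r%:R + 1).
  near: u; apply/nbhs_ballP; exists (e / (r%:R + 1)) => // u.
  by rewrite -ball_normE => /ltW.
have le1 (a b : 'rV[R]_r) : norm1 a - norm1 b <= r%:R * `|a - b|.
  rewrite lerBlDr -{1}[a](subrK b) (le_trans (ler_norm1D _ _)) // lerD2r.
  exact: ler_norm1_norm.
apply: (@le_trans _ _ (r%:R * `|v - u|)).
  by rewrite ler_norml le1 andbT lerNl opprB distrC le1.
apply: (@le_trans _ _ ((r%:R + 1) * `|v - u|)).
  by rewrite ler_wpM2r // lerDl.
by rewrite mulrC -ler_pdivlMr // ltr_wpDl.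
Unshelve. all: by end_near. Qed.

Lemma norm1_continuous r : continuous (@norm1 r).
Proof. by move=> v; exact: cvg_norm1. Qed.

(** Minimise [norm1 (g z) + delta * `|z - y|] over the points of [S] in a compact
    ball.  Comparison with [y] itself bounds the distance from [y] to the minimiser
    by a multiple of the residual, so the minimiser is interior to the ball.  If its
    residual were nonzero, [robinson_descent] would provide a move whose gain
    exceeds what the penalty charges for it. *)
Lemma robinson_error_bound n r (S : set 'rV[R]_n) (x : 'rV[R]_n)
    (g : 'rV[R]_n -> 'rV[R]_r) (J : 'rV[R]_n -> 'M[R]_(n, r))
    (K : 'M[R]_(r, n)) (r0 C : R) :
  closed S -> convex_set S -> S x -> g x = 0 -> 0 < r0 -> 0 <= C ->
  smooth_on_ball g J x r0 C ->
  (forall i (b : bool), tangent_cone S x ((-1) ^+ b *: row i K)) ->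
  K *m J x = 1%:M ->
  exists kappa eta : R, [/\ 0 < kappa, 0 < eta &
    forall y, S y -> `|y - x| <= eta ->
      exists y', [/\ S y', g y' = 0 & `|y' - y| <= kappa * `|g y|]].
Proof.
move=> Scl cS Sx gx0 r00 C0 gJ TK KJ.
have [rho [M [r1 [rho0 M0 /andP[r10 r1r0] desc]]]] :=
  robinson_descent cS Sx r00 C0 gJ TK KJ.
have [gc gT _] := gJ.
(* a move of length t * M costs at most half of the decrease t * rho *)
pose delta := rho / (2 * M).
have M20 : 0 < 2 * M by rewrite mulr_gt0.
have delta0 : 0 < delta by rewrite divr_gt0.
pose kappa := (r%:R + 1) / delta.
have kappa0 : 0 < kappa by rewrite divr_gt0 // ltr_wpDl.
pose c := n%:R * `|J x| + C.
have c0 : 0 <= c by rewrite addr_ge0 // mulr_ge0.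
have ck0 : 0 < 1 + kappa * c by rewrite ltr_pwDl // mulr_ge0 // ltW.
have [eta [eta0 eta1 etar1 etak]] : exists eta : R,
    [/\ 0 < eta, eta <= 1, eta < r1 & eta < r1 / (1 + kappa * c)].
  near (0 : R)^'+ => eta; exists eta; split; near: eta.
  - exact: nbhs_right_gt.
  - exact: nbhs_right_le.
  - exact: nbhs_right_lt.
  - by apply: nbhs_right_lt; rewrite divr_gt0.
exists kappa, eta; split=> // y Sy yx.
have yr1 : `|y - x| < r1 by exact: le_lt_trans etar1.
have gyc : `|g y| <= c * eta.
  have xr0 : `|x - x| < r0 by rewrite subrr normr0.
  have := gT x y xr0 (lt_trans yr1 r1r0); rewrite gx0 subr0 => h.
  rewrite -[g y](subrK ((y - x) *m J x)) (le_trans (ler_normD _ _)) //.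
  rewrite /c mulrDl addrC lerD //.
    rewrite (le_trans (ler_norm_mulmx _ _)) // -!mulrA ler_wpM2l // mulrC.
    by rewrite ler_wpM2l.
  rewrite (le_trans h) // ler_wpM2l // (le_trans _ yx) // expr2 ler_piMr //.
  exact: le_trans eta1.
pose phi z := norm1 (g z) + delta * `|z - y|.
pose A := S `&` [set z | `|z - x| <= r1].
have normc (a : 'rV[R]_n) : continuous (fun z : 'rV[R]_n => `|z - a|).
  have za : continuous (fun z : 'rV[R]_n => z - a).
    move=> z; apply: continuousB; [exact: (fun _ => id)|exact: cst_continuous].
  by move=> z; exact: (cvg_norm (za z)).
have phic (z : 'rV[R]_n) : `|z - x| <= r1 -> {for z, continuous phi}.
  move=> zr1.
  have c1 : {for z, continuous (fun u => norm1 (g u))}.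
    apply: (@continuous_comp _ _ _ g (@norm1 r)); last exact: norm1_continuous.
    by apply: gc; exact: le_lt_trans r1r0.
  have c2 : {for z, continuous (fun u : 'rV[R]_n => delta * `|u - y|)}.
    apply: (@continuousM _ _ (fun=> delta) (fun u : 'rV[R]_n => `|u - y|)).
      exact: cst_continuous.
    exact: normc.
  exact: (continuousD c1 c2).
have Acl : closed A.
  apply: closedI => //.
  apply: (@preimage_closed _ _ (fun z : 'rV[R]_n => `|z - x|) [set u | u <= r1]).
    by move=> z _; exact: normc.
  exact: closed_le.
have cA : compact A by apply: (@bounded_ball_compact _ _ _ x r1 Acl) => z [].
have [|||ys] := @EVT_min_rV R n phi A.
- by exists y; split=> //=; exact: ltW.
- exact: cA.
- apply: continuous_in_subspaceT => z; rewrite inE => -[_ zr1].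
  exact: phic.
rewrite inE => -[Sys /= ysr1] ymin.
have phiy : phi ys <= norm1 (g y).
  have /ymin : y \in A by rewrite inE; split=> //=; exact: ltW.
  by rewrite /phi subrr normr0 mulr0 addr0.
have ysy : `|ys - y| <= kappa * `|g y|.
  rewrite /kappa mulrAC ler_pdivlMr // mulrC.
  apply: (@le_trans _ _ (norm1 (g y))).
    by apply: le_trans phiy; rewrite /phi lerDr norm1_ge0.
  by rewrite (le_trans (ler_norm1_norm _)) // ler_wpM2r // lerDl.
exists ys; split=> //; apply/eqP/negPn/negP => gys0.
have ysx : `|ys - x| < r1.
  rewrite -(subrKA y) (le_lt_trans (ler_normD _ _)) //.
  apply: (@le_lt_trans _ _ (eta * (1 + kappa * c))).
    rewrite mulrDr mulr1 addrC lerD // (le_trans ysy) //.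
    by rewrite mulrCA ler_wpM2l ?(ltW kappa0) // mulrC.
  by rewrite -ltr_pdivlMr.
have [w wM [t t0 [St tr1 dec]]] := desc ys Sys ysx gys0.
have /ymin : ys + t *: w \in A by rewrite inE; split=> //=; exact: ltW.
apply/negP; rewrite -ltNge /phi.
apply: (@le_lt_trans _ _ (norm1 (g ys) - t * rho + delta * (`|ys - y| + t * M))).
  rewrite lerD // ler_wpM2l ?(ltW delta0) // addrAC (le_trans (ler_normD _ _)) //.
  by rewrite lerD2l normrZ gtr0_norm // ler_wpM2l // ltW.
have -> : norm1 (g ys) - t * rho + delta * (`|ys - y| + t * M) =
    norm1 (g ys) + delta * `|ys - y| - t * (rho - delta * M) by ring.
rewrite ltrBlDr ltrDl mulr_gt0 //.
have -> : delta * M = rho / 2 by rewrite /delta; field; rewrite gt_eqF.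
lra.
Unshelve. all: by end_near. Qed.

End ErrorBound.

(** * Redundant constraints of constant rank *)

Section ConstantRank.
Context {R : realType}.

Lemma vspace_frame p (U : {vspace 'rV[R]_p}) r : \dim U = r ->
  exists M : 'M[R]_(r, p), (forall i, row i M \in U) /\ row_free M.
Proof.
move=> <-; exists (\matrix_i (vbasis U)`_i); split.
  by move=> i; rewrite rowK vbasis_mem // mem_nth // size_tuple.
apply: inj_row_free => a aM0.
have /freeP F := basis_free (vbasisP U).
have := F (fun i => a 0 i).
rewrite -[X in X = 0 -> _]/(\sum_i _) => H.
apply/rowP => i; rewrite mxE; apply: H.
rewrite -[RHS]aM0 mulmx_sum_row; apply: eq_bigr => j _; by rewrite rowK.
Qed.

Lemma frame_span p (U : {vspace 'rV[R]_p}) r (M : 'M[R]_(r, p)) : \dim U = r ->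
  (forall i, row i M \in U) -> row_free M ->
  forall u, u \in U -> exists a : 'rV[R]_r, u = a *m M.
Proof.
move=> dU MU Mf u uU.
pose s := [tuple row i M | i < r].
have sE (i : 'I_r) : s`_i = row i M.
  by rewrite -tnth_nth tnth_mktuple.
have sf : free s.
  apply/freeP => k k0 i.
  have : (\row_i k i) *m M = 0.
    rewrite mulmx_sum_row -[RHS]k0; apply: eq_bigr => j _.
    by rewrite mxE sE.
  move/(congr1 (fun v => v *m pinvmx M)); rewrite mulmxKp // mul0mx.
  by move/rowP/(_ i); rewrite !mxE.
have sU : (span s <= U)%VS.
  by apply/span_subvP => v /mapP[i _ ->]; exact: MU.
have sB : basis_of U s.
  by rewrite basisEfree sf sU dU size_tuple leqnn.
exists (\row_i coord s i u).
rewrite mulmx_sum_row {1}(coord_basis sB uU); apply: eq_bigr => i _.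
by rewrite mxE sE.
Qed.

(** As an operator [M *m W] is within 1/2 of the identity: [W] nearly inverts
    [M], so that coefficients can be recovered from [a *m M *m W] up to a factor 2. *)
Lemma row_free_near1 r p (M : 'M[R]_(r, p)) (W : 'M[R]_(p, r)) :
  2 * r%:R * `|M *m W - 1%:M| <= 1 ->
  (forall a : 'rV[R]_r, `|a| <= 2 * `|a *m M *m W|) /\ row_free M.
Proof.
move=> h.
have bd (a : 'rV[R]_r) : `|a| <= 2 * `|a *m M *m W|.
  have E : a = a *m M *m W - a *m (M *m W - 1%:M).
    by rewrite mulmxBr mulmx1 mulmxA opprB addrC subrK.
  have : `|a| <= `|a *m M *m W| + r%:R * `|a| * `|M *m W - 1%:M|.
    by rewrite {1}E (le_trans (ler_normB _ _)) // lerD2l ler_norm_mulmx.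
  have : (2 * r%:R * `|M *m W - 1%:M|) * `|a| <= 1 * `|a|.
    by rewrite ler_wpM2r.
  lra.
split=> //; apply: inj_row_free => a aM; apply/eqP; rewrite -normr_le0.
by rewrite (le_trans (bd a)) // aM mul0mx normr0 mulr0.
Qed.

(** A basis of the image of the lineality space of the tangent cone, lifted to
    lineality directions [row i K].  The matrix [W] selects as many combinations of
    the constraints as there are independent ones; for these the constraint
    qualification of Robinson holds at [x]. *)
Lemma transversal_frame n p (X : set 'rV[R]_n) (x : 'rV[R]_n)
    (J : 'M[R]_(n, p)) r : X x ->
  has_dim [set d *m J | d in
     tangent_cone X x `&` [set d | tangent_cone X x (- d)]] r ->
  exists (K : 'M[R]_(r, n)) (W : 'M[R]_(p, r)),
    (forall i (b : bool), tangent_cone X x ((-1) ^+ b *: row i K)) /\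
    K *m J *m W = 1%:M.
Proof.
move=> Xx [U UE dU].
have [M [MU Mf]] := vspace_frame dU.
have H i : exists d, (tangent_cone X x d /\ tangent_cone X x (- d)) /\
    d *m J = row i M.
  have : [set v | v \in U] (row i M) by exact: MU.
  by rewrite -UE => -[d Td dJ]; exists d.
have [k kP] := choice H.
pose K : 'M[R]_(r, n) := \matrix_i k i.
exists K, (pinvmx M); split.
  move=> i b; rewrite rowK; have [[T1 T2] _] := kP i.
  by case: b; rewrite ?expr1 ?scaleN1r ?expr0 ?scale1r.
have -> : K *m J = M.
  by apply/row_matrixP => i; rewrite row_mul rowK; have [] := kP i.
exact: mulmxVp.
Qed.

Lemma smooth_on_ball_mulmxr n p r (c : 'rV[R]_n -> 'rV[R]_p)
    (J : 'rV[R]_n -> 'M[R]_(n, p)) (W : 'M[R]_(p, r)) x (r0 C : R) :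
  0 <= C -> smooth_on_ball c J x r0 C ->
  smooth_on_ball (fun y => c y *m W) (fun y => J y *m W) x r0
    (p%:R * C * `|W|).
Proof.
move=> C0 [cc cT cL]; split.
- move=> y yr; apply: (@continuous_comp _ _ _ c (fun v => v *m W)).
    exact: cc.
  exact: mulmxr_continuous.
- move=> y z yr zr; rewrite mulmxA -!mulmxBl.
  rewrite (le_trans (ler_norm_mulmx _ _)) // [leRHS]mulrAC ler_wpM2r // -[leRHS]mulrA.
  by rewrite ler_wpM2l // cT.
- move=> y z yr zr; rewrite -mulmxBl.
  rewrite (le_trans (ler_norm_mulmx _ _)) // [leRHS]mulrAC ler_wpM2r // -[leRHS]mulrA.
  by rewrite ler_wpM2l // cL.
Qed.

(** Near [x] the images of the rows of [K] stay independent.  Constancy of the rank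
    then forces them to span the image of all directions, so that the derivative of
    the selected constraints controls the derivative of all of them. *)
Lemma constant_rank_bound n p r (X : set 'rV[R]_n) (x : 'rV[R]_n)
    (J : 'rV[R]_n -> 'M[R]_(n, p)) (K : 'M[R]_(r, n)) (W : 'M[R]_(p, r))
    (r0 C tau : R) :
  X x -> 0 < r0 -> 0 <= C -> 0 < tau ->
  (forall y z, `|y - x| < r0 -> `|z - x| < r0 -> `|J y - J z| <= C * `|y - z|) ->
  (forall y, affine_hull X y -> `|y - x| < tau ->
     has_dim [set d *m J y | d in direction X x] r) ->
  (forall i, direction X x (row i K)) -> K *m J x *m W = 1%:M ->
  exists r1 C1 : R, [/\ 0 < r1, 0 <= C1 &
    forall y, affine_hull X y -> `|y - x| < r1 ->
    forall d, direction X x d ->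
      (exists a : 'rV[R]_r, d *m J y = a *m (K *m J y)) /\
      `|d *m J y| <= C1 * `|d *m J y *m W|].
Proof.
move=> Xx r00 C0 tau0 JL rk XK KJW.
pose c1 := 2 * r%:R * (p%:R * (n%:R * `|K| * C) * `|W|) + 1.
have c10 : 0 < c1 by rewrite ltr_wpDl // !mulr_ge0.
have [r1 [r10 r11 r1r0 r1tau r1c]] : exists r1 : R,
    [/\ 0 < r1, r1 <= 1, r1 < r0, r1 < tau & r1 <= 1 / c1].
  near (0 : R)^'+ => r1; exists r1; split; near: r1.
  - exact: nbhs_right_gt.
  - exact: nbhs_right_le.
  - exact: nbhs_right_lt.
  - exact: nbhs_right_lt.
  - by apply: nbhs_right_le; rewrite divr_gt0.
exists r1, (r%:R * 2 * (n%:R * `|K| * (`|J x| + C))); split=> //.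
  by rewrite !mulr_ge0 // addr_ge0.
move=> y Xy yr1 d Xd.
have yr0 : `|y - x| < r0 by exact: lt_trans r1r0.
have xr0 : `|x - x| < r0 by rewrite subrr normr0.
have JyJx : `|J y - J x| <= C * r1.
  by rewrite (le_trans (JL y x yr0 xr0)) // ler_wpM2l // ltW.
have near1 : 2 * r%:R * `|K *m J y *m W - 1%:M| <= 1.
  rewrite -KJW -mulmxBl -mulmxBr.
  apply: (@le_trans _ _ (2 * r%:R * (p%:R * (n%:R * `|K| * (C * r1)) * `|W|))).
    rewrite ler_wpM2l ?mulr_ge0 // (le_trans (ler_norm_mulmx _ _)) //.
    rewrite ler_wpM2r // ler_wpM2l // (le_trans (ler_norm_mulmx _ _)) //.
    by rewrite ler_wpM2l // mulr_ge0.
  apply: (@le_trans _ _ (c1 * r1)); last by rewrite mulrC -ler_pdivlMr.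
  have -> : 2 * r%:R * (p%:R * (n%:R * `|K| * (C * r1)) * `|W|) = (c1 - 1) * r1.
    by rewrite /c1; ring.
  by rewrite ler_wpM2r ?(ltW r10) // gerBl.
have [bd Mf] := row_free_near1 near1.
have [U UE dU] := rk y Xy (lt_trans yr1 r1tau).
have KU i : row i (K *m J y) \in U.
  have : [set d *m J y | d in direction X x] (row i (K *m J y)).
    by exists (row i K) => //; rewrite row_mul.
  by rewrite UE.
have dJU : d *m J y \in U.
  have : [set d *m J y | d in direction X x] (d *m J y) by exists d.
  by rewrite UE.
have [a aE] := frame_span dU KU Mf dJU.
split; first by exists a.
have := bd a; rewrite -aE => abd; rewrite {1}aE.
rewrite (le_trans (ler_norm_mulmx _ _)) //.
apply: (@le_trans _ _ (r%:R * (2 * `|d *m J y *m W|) * (n%:R * `|K| * (`|J x| + C)))).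
  rewrite ler_pM ?mulr_ge0 // ?ler_wpM2l //.
  rewrite (le_trans (ler_norm_mulmx _ _)) // ler_wpM2l ?mulr_ge0 //.
  rewrite -[J y](subrK (J x)) addrC (le_trans (ler_normD _ _)) // lerD2l.
  by rewrite (le_trans JyJx) // ler_piMr.
by rewrite le_eqVlt; apply/orP; left; apply/eqP; ring.
Unshelve. all: by end_near. Qed.

(** If a map varies at most quadratically along a set in which any two points have
    an approximate midpoint, then cutting at the midpoint improves the constant
    of the quadratic bound, and iterating drives it to 0.  The conditions on
    [`|y - x| + `|z - y|] keep all the points constructed in a fixed ball around
    [x]. *)
Lemma bisection_vanish n p (N : set 'rV[R]_n) (c : 'rV[R]_n -> 'rV[R]_p)
    (x : 'rV[R]_n) (r2 C2 : R) :
  0 <= C2 ->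
  (forall y z, N y -> N z -> `|y - x| + `|z - y| <= r2 ->
     `|z - x| + `|z - y| <= r2 -> `|c z - c y| <= C2 * `|z - y| ^+ 2) ->
  (forall y z, N y -> N z -> `|y - x| + `|z - y| <= r2 ->
     `|z - x| + `|z - y| <= r2 ->
     exists2 m, N m & `|m - 2^-1 *: (y + z)| <= 8^-1 * `|z - y|) ->
  forall y z, N y -> N z -> `|y - x| + `|z - y| <= r2 ->
     `|z - x| + `|z - y| <= r2 -> c z = c y.
Proof.
move=> C20 quad mid.
have main (k : nat) : forall y z, N y -> N z -> `|y - x| + `|z - y| <= r2 ->
   `|z - x| + `|z - y| <= r2 ->
   `|c z - c y| <= C2 * (25 / 32) ^+ k * `|z - y| ^+ 2.
  elim: k => [|k IH] y z Ny Nz yr zr.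
    by rewrite expr0 mulr1; exact: quad.
  have [m Nm mE] := mid y z Ny Nz yr zr.
  set m0 := 2^-1 *: (y + z) in mE.
  set D := `|z - y| in yr zr mE *.
  have my : `|m - y| <= 5 / 8 * D.
    have -> : m - y = (m - m0) + 2^-1 *: (z - y).
      by apply/rowP => j; rewrite !mxE; field.
    have h : `|2^-1 *: (z - y)| = D / 2 by rewrite normrZ ger0_norm // mulrC.
    by rewrite (le_trans (ler_normD _ _)) // h; lra.
  have zm : `|z - m| <= 5 / 8 * D.
    have -> : z - m = 2^-1 *: (z - y) - (m - m0).
      by apply/rowP => j; rewrite !mxE; field.
    have h : `|2^-1 *: (z - y)| = D / 2 by rewrite normrZ ger0_norm // mulrC.
    by rewrite (le_trans (ler_normB _ _)) // h; lra.
  have mx : `|m - x| <= 8^-1 * D + (`|y - x| + `|z - x|) / 2.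
    have -> : m - x = (m - m0) + 2^-1 *: ((y - x) + (z - x)).
      by apply/rowP => j; rewrite !mxE; field.
    rewrite (le_trans (ler_normD _ _)) // lerD // normrZ ger0_norm // mulrC.
    by rewrite ler_wpM2r // ler_normD.
  have D0 : 0 <= D by exact: normr_ge0.
  have h1 : `|c m - c y| <= C2 * (25 / 32) ^+ k * `|m - y| ^+ 2.
    by apply: IH => //; lra.
  have h2 : `|c z - c m| <= C2 * (25 / 32) ^+ k * `|z - m| ^+ 2.
    by apply: IH => //; lra.
  rewrite -(subrKA (c m)) (le_trans (ler_normD _ _)) //.
  set q := C2 * _ in h1 h2.
  have q0 : 0 <= q by rewrite mulr_ge0 // exprn_ge0 // divr_ge0.
  have sq (u : 'rV[R]_n) : `|u| <= 5 / 8 * D -> q * `|u| ^+ 2 <= q * (5 / 8 * D) ^+ 2.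
    move=> uD; rewrite ler_wpM2l // lerXn2r ?nnegrE //.
    by rewrite mulr_ge0 // divr_ge0.
  have := lerD (le_trans h2 (sq _ zm)) (le_trans h1 (sq _ my)).
  move/le_trans; apply.
  (* both halves have length at most 5/8 of D, and 25/32 is 2 * (5/8) ^+ 2 *)
  suff -> : C2 * (25 / 32) ^+ k.+1 * D ^+ 2 =
      q * (5 / 8 * D) ^+ 2 + q * (5 / 8 * D) ^+ 2 by [].
  by rewrite /q exprS; move: ((25 / 32) ^+ k) => a; field.
move=> y z Ny Nz yr zr.
apply/eqP; rewrite -subr_eq0 -normr_le0.
pose u (k : nat) : R := C2 * (25 / 32) ^+ k * `|z - y| ^+ 2.
have u0 : u @ \oo --> (0 : R).
  rewrite -(mul0r (`|z - y| ^+ 2)) -(mulr0 C2).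
  apply: cvgMr_tmp; apply: cvgMl_tmp; apply: cvg_expr.
  by rewrite ger0_norm; lra.
by apply: (cvgr_to_ge u0); apply: nearW => k; exact: main.
Qed.

(** Two zeros of the selected constraints have values of [c] that differ only
    quadratically, because the derivative of [c] is dominated by that of the
    selection.  The midpoint of two such zeros has a quadratically small residual,
    so [robinson_error_bound], applied to the affine hull, corrects it to a zero
    without moving it much.  Then [bisection_vanish] shows that [c] is constant on
    these zeros. *)
Lemma constant_rank_zero n p r (X : set 'rV[R]_n) (x : 'rV[R]_n)
    (c : 'rV[R]_n -> 'rV[R]_p) (J : 'rV[R]_n -> 'M[R]_(n, p))
    (K : 'M[R]_(r, n)) (W : 'M[R]_(p, r)) (r0 C tau : R) :
  X x -> c x = 0 -> 0 < r0 -> 0 <= C -> 0 < tau -> smooth_on_ball c J x r0 C ->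
  (forall y, affine_hull X y -> `|y - x| < tau ->
     has_dim [set d *m J y | d in direction X x] r) ->
  (forall i (b : bool), tangent_cone X x ((-1) ^+ b *: row i K)) ->
  K *m J x *m W = 1%:M ->
  exists2 r1 : R, 0 < r1 & forall y, affine_hull X y -> `|y - x| <= r1 ->
    c y *m W = 0 -> c y = 0.
Proof.
move=> Xx cx0 r00 C0 tau0 cs rk TK KJW.
have [cc cT cL] := cs.
have XK i : direction X x (row i K).
  by apply: tangent_cone_direction => //; have := TK i false; rewrite expr0 scale1r.
have [r1 [C1 [r10 C10 bd]]] := constant_rank_bound Xx r00 C0 tau0 cL rk XK KJW.
have gs := smooth_on_ball_mulmxr W C0 cs.
set g := fun y => c y *m W in gs; set Jg := fun y => J y *m W in gs.
have [_ gT _] := gs.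
set Cg := p%:R * C * `|W| in gs gT.
have Cg0 : 0 <= Cg by rewrite !mulr_ge0.
have gx0 : g x = 0 by rewrite /g cx0 mul0mx.
have KJg : K *m Jg x = 1%:M by rewrite /Jg mulmxA.
have Tah i (b : bool) : tangent_cone (affine_hull X) x ((-1) ^+ b *: row i K).
  exact: (tangent_cone_mono (@subset_affine_hull _ _ X) (TK i b)).
have [kappa [eta [kappa0 eta0 eb]]] := robinson_error_bound
  (closed_affine_hull Xx) (convex_affine_hull (X:=X)) (subset_affine_hull Xx)
  gx0 r00 Cg0 gs Tah KJg.
have kC0 : 0 <= kappa * Cg by rewrite mulr_ge0 // ltW.
have kC1 : 0 < 8 * (kappa * Cg) + 1 by rewrite ltr_wpDl // mulr_ge0.
have [r2 [r20 r2r0 r2r1 r2eta r2k]] : exists r2 : R, [/\ 0 < r2, r2 < r0, r2 < r1,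
    r2 <= eta & r2 <= 1 / (8 * (kappa * Cg) + 1)].
  near (0 : R)^'+ => r2; exists r2; split; near: r2.
  - exact: nbhs_right_gt.
  - exact: nbhs_right_lt.
  - exact: nbhs_right_lt.
  - exact: nbhs_right_le.
  - by apply: nbhs_right_le; rewrite divr_gt0.
pose N := affine_hull X `&` [set y | g y = 0].
have xN : N x by split; [exact: subset_affine_hull | exact: gx0].
have quad y z : N y -> N z -> `|y - x| + `|z - y| <= r2 ->
     `|z - x| + `|z - y| <= r2 -> `|c z - c y| <= (C1 * Cg + C) * `|z - y| ^+ 2.
  move=> [Xy gy] [Xz gz] yr zr.
  have yr2 : `|y - x| <= r2 by apply: le_trans yr; rewrite lerDl.
  have zr2 : `|z - x| <= r2 by apply: le_trans zr; rewrite lerDl.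
  have yr0 := le_lt_trans yr2 r2r0; have zr0 := le_lt_trans zr2 r2r0.
  have Xd : direction X x (z - y).
    rewrite -(subrKA x); apply: directionD => //.
      exact/direction_affine_hull.
    by rewrite -opprB -scaleN1r; apply: directionZ => //; exact/direction_affine_hull.
  have [_ dJ] := bd y Xy (le_lt_trans yr2 r2r1) _ Xd.
  have := gT y z yr0 zr0; rewrite gy gz subrr sub0r normrN => gb.
  rewrite -[c z - c y](subrK ((z - y) *m J y)) addrC (le_trans (ler_normD _ _)) //.
  rewrite mulrDl lerD ?cT // (le_trans dJ) // -mulrA ler_wpM2l //.
  by move: gb; rewrite /Jg mulmxA.
have mid y z : N y -> N z -> `|y - x| + `|z - y| <= r2 ->
     `|z - x| + `|z - y| <= r2 ->
     exists2 m, N m & `|m - 2^-1 *: (y + z)| <= 8^-1 * `|z - y|.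
  move=> [Xy gy] [Xz gz] yr zr.
  have yr2 : `|y - x| <= r2 by apply: le_trans yr; rewrite lerDl.
  have zr2 : `|z - x| <= r2 by apply: le_trans zr; rewrite lerDl.
  have Dr2 : `|z - y| <= r2 by apply: le_trans yr; rewrite lerDr.
  have yr0 := le_lt_trans yr2 r2r0; have zr0 := le_lt_trans zr2 r2r0.
  set D := `|z - y| in Dr2 *.
  have D0 : 0 <= D by exact: normr_ge0.
  pose m0 := 2^-1 *: (y + z).
  have m0y : m0 - y = 2^-1 *: (z - y).
    by apply/rowP => j; rewrite !mxE; field.
  have Xm0 : affine_hull X m0.
    by rewrite -[m0](subrK y) m0y addrC; exact: affine_hull_line.
  have m0x : `|m0 - x| <= r2.
    have -> : m0 - x = 2^-1 *: ((y - x) + (z - x)).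
      by apply/rowP => j; rewrite !mxE; field.
    rewrite normrZ ger0_norm // mulrC ler_pdivrMr //.
    by rewrite (le_trans (ler_normD _ _)) // mulr_natr mulr2n lerD.
  have gz1 := gT y z yr0 zr0; rewrite gy gz subrr sub0r normrN in gz1.
  have gm1 := gT y m0 yr0 (le_lt_trans m0x r2r0).
  rewrite gy subr0 m0y -scalemxAl in gm1.
  have gm0 : `|g m0| <= Cg * D ^+ 2.
    rewrite -[g m0](subrK (2^-1 *: ((z - y) *m Jg y))).
    rewrite (le_trans (ler_normD _ _)) //.
    rewrite [`|2^-1 *: (_ *m _)|]normrZ [`|2^-1|]ger0_norm //.
    have E : `|2^-1 *: (z - y)| = 2^-1 * D by rewrite normrZ ger0_norm.
    rewrite E in gm1.
    have : Cg * (2^-1 * D) ^+ 2 = 4^-1 * (Cg * D ^+ 2) by field.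
    have : 0 <= Cg * D ^+ 2 by rewrite mulr_ge0 // sqr_ge0.
    move: gm1 gz1; rewrite -/D; lra.
  have [m [Xm gm mm0]] := eb m0 Xm0 (le_trans m0x r2eta).
  exists m => //; rewrite (le_trans mm0) //.
  apply: (@le_trans _ _ (kappa * (Cg * D ^+ 2))); first by rewrite ler_wpM2l // ltW.
  have -> : kappa * (Cg * D ^+ 2) = (kappa * Cg * D) * D by ring.
  rewrite ler_wpM2r //.
  have : (8 * (kappa * Cg) + 1) * D <= 1.
    by rewrite mulrC -ler_pdivlMr // (le_trans Dr2).
  lra.
exists (r2 / 2); first by rewrite divr_gt0.
move=> y Xy yr gy; rewrite -cx0.
have C20 : 0 <= C1 * Cg + C by rewrite addr_ge0 // mulr_ge0.
apply: (bisection_vanish C20 quad mid) => //.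
  by rewrite subrr normr0 add0r (le_trans yr) // ler_pdivrMr // ler_peMr // ?ltW //; lra.
lra.
Unshelve. all: by end_near. Qed.

End ConstantRank.

(** * Approximating tangent directions by feasible points *)

Section LocalRegularity.
Context {R : realType}.

Lemma locally_lipschitz_ball n (V : normedModType R) (D : set 'rV[R]_n)
    (F : 'rV[R]_n -> V) (x : 'rV[R]_n) :
  [locally [lipschitz F y | y in D]] -> D x ->
  exists r C : R, [/\ 0 < r, 0 <= C & forall y z, D y -> D z ->
    `|y - x| < r -> `|z - x| < r -> `|F y - F z| <= C * `|y - z|].
Proof.
move=> FL Dx.
have /pinfty_ex_gt0[C C0] := FL (x, x) (conj Dx Dx).
rewrite /dominated_by /self_sub /= => /nbhs_ballP[r r0 rP].
exists r, C; split=> // [|y z Dy Dz yr zr]; first exact: ltW.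
apply: (rP (y, z)) => //.
by split; rewrite -ball_normE /= distrC.
Qed.

(** [robinson_error_bound] on [X] yields a nearby point of [X] annihilating the
    selected constraints, and [constant_rank_zero] says that such a point
    satisfies all of them. *)
Lemma local_regularity n p (X Y : set 'rV[R]_n) (f : 'rV[R]_n -> R)
    (c : 'rV[R]_n -> 'rV[R]_p) (x : 'rV[R]_n) :
  closed X -> convex_set X -> open Y -> X `<=` Y -> regular_data X Y f c ->
  feasible X c x ->
  exists (r : nat) (K : 'M[R]_(r, n)) (W : 'M[R]_(p, r)),
  [/\ forall i (b : bool), tangent_cone X x ((-1) ^+ b *: row i K),
      K *m 'J c x *m W = 1%:M,
      forall d, direction X x d ->
        exists a : 'rV[R]_r, d *m 'J c x = a *m (K *m 'J c x)
    & exists kappa eta : R, [/\ 0 < kappa, 0 < eta &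
        forall y, X y -> `|y - x| <= eta ->
        exists2 y', feasible X c y' & `|y' - y| <= kappa * `|c y|]].
Proof.
move=> Xcl cX oY XY [_ [cd _ cL] [r _ reg]] [Xx cx0].
have [tau tau0 [regE regT]] := reg x (conj Xx cx0).
have Yx := XY x Xx.
have xx_enorm : enorm (x - x) <= tau.
  by rewrite subrr /enorm dot0r sqrtr0 ltW.
have [K [W [TK KJW]]] := transversal_frame Xx (regT x Xx xx_enorm).
exists r, K, W.
have [r1 [L [r10 L0 JL]]] := locally_lipschitz_ball cL Yx.
have [r2 r20 r2Y] : exists2 r2 : R, 0 < r2 & forall y, `|y - x| < r2 -> Y y.
  have : nbhs x Y by exact: open_nbhs_nbhs.
  move=> /nbhs_ballP[r2 r20 r2P]; exists r2 => // y yr; apply: r2P.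
  by rewrite -ball_normE /= distrC.
pose r0 := Num.min r1 r2.
have r00 : 0 < r0 by rewrite lt_min r10.
have br1 y : `|y - x| < r0 -> `|y - x| < r1 by rewrite lt_min => /andP[].
have br2 y : `|y - x| < r0 -> Y y by rewrite lt_min => /andP[_ /r2Y].
have JL' y z : `|y - x| < r0 -> `|z - x| < r0 ->
    `|'J c y - 'J c z| <= L * `|y - z|.
  by move=> yr zr; apply: JL; [exact: br2|exact: br2|exact: br1|exact: br1].
pose C := Num.max L (n%:R * L).
have C0 : 0 <= C by rewrite le_max L0.
have cs : smooth_on_ball c (jacobian c) x r0 C.
  split.
  - by move=> y yr; apply: differentiable_continuous; apply: cd; exact: br2.
  - move=> y z yr zr.
    apply: (le_trans (taylor_bound _ JL' yr zr)).
      by move=> u ur; apply: cd; exact: br2.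
    by rewrite ler_wpM2r ?sqr_ge0 // le_max lexx orbT.
  - move=> y z yr zr; rewrite (le_trans (JL' y z yr zr)) //.
    by rewrite ler_wpM2r // le_max lexx.
pose tau1 := Num.min r0 (tau / (n%:R + 1)).
have n10 : 0 < n%:R + 1 :> R by rewrite ltr_wpDl.
have tau10 : 0 < tau1 by rewrite lt_min r00 divr_gt0.
have rk y : affine_hull X y -> `|y - x| < tau1 ->
     has_dim [set d *m 'J c y | d in direction X x] r.
  move=> Xy; rewrite lt_min => /andP[yr0 ytau]; apply: regE => //.
    exact: br2.
  rewrite (le_trans (enorm_le _)) // mulrC -ler_pdivlMr //.
  exact: ltW.
have XK i : direction X x (row i K).
  by apply: tangent_cone_direction => //; have := TK i false; rewrite expr0 scale1r.
have [_ _ cL0] := cs.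
split=> //.
  have [s [C1 [s0 _ bd]]] := constant_rank_bound Xx r00 C0 tau10 cL0 rk XK KJW.
  have xs : `|x - x| < s by rewrite subrr normr0.
  by move=> d Xd; have [] := bd x (subset_affine_hull Xx) xs d Xd.
have [s s0 czero] := constant_rank_zero Xx cx0 r00 C0 tau10 cs rk TK KJW.
pose g y := c y *m W.
have gx0 : g x = 0 by rewrite /g cx0 mul0mx.
have Cg0 : 0 <= p%:R * C * `|W| by rewrite !mulr_ge0.
have KJg : K *m ('J c x *m W) = 1%:M by rewrite mulmxA.
have gs := smooth_on_ball_mulmxr W C0 cs.
have [kappa [eta [kappa0 eta0 eb]]] := robinson_error_bound
  Xcl cX Xx gx0 r00 Cg0 gs TK KJg.
pose k2 := kappa * (p%:R * `|W|) + 1.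
have k20 : 0 < k2 by rewrite ltr_wpDl // !mulr_ge0 // ltW.
have gk y : kappa * `|g y| <= k2 * `|c y|.
  apply: (@le_trans _ _ (kappa * (p%:R * `|W|) * `|c y|)).
    rewrite -mulrA ler_wpM2l ?(ltW kappa0) // (le_trans (ler_norm_mulmx _ _)) //.
    by rewrite mulrAC.
  by rewrite ler_wpM2r // lerDl.
have cc : {for x, continuous c} by apply: differentiable_continuous; exact: cd.
have [e e0 ce] : exists2 e : R, 0 < e &
    forall y, `|y - x| < e -> `|c y| <= s / 2 / k2.
  have /cvgrPdist_le/(_ (s / 2 / k2)) := cc.
  rewrite !divr_gt0 // => /(_ isT) /nbhs_ballP[e e0 eP]; exists e => // y ye.
  have := eP y; rewrite -ball_normE /= distrC => /(_ ye).
  by rewrite cx0 sub0r normrN.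
have [eta' [h1 h2 h3 h4]] : exists eta' : R,
    [/\ 0 < eta', eta' < e, eta' <= eta & eta' <= s / 2].
  near (0 : R)^'+ => t; exists t; split; near: t.
  - exact: nbhs_right_gt.
  - exact: nbhs_right_lt.
  - exact: nbhs_right_le.
  - by apply: nbhs_right_le; rewrite divr_gt0.
exists k2, eta'; split=> // y Xy yx.
have [y' [Xy' gy' yy']] := eb y Xy (le_trans yx h3).
have yy2 := le_trans yy' (gk y).
exists y' => //; split=> //; apply: czero => //.
  exact: subset_affine_hull.
rewrite -(subrKA y) (le_trans (ler_normD _ _)) //.
rewrite [leRHS]splitr lerD // ?(le_trans yx) //.
rewrite (le_trans yy2) // mulrC -ler_pdivlMr //.
by apply: ce; exact: le_lt_trans h2.
Unshelve. all: by end_near. Qed.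

(** As [d] lies in the kernel of the derivative, [c] is small of first order along
    the given sequence, and the error bound turns this into a correction of the
    points that does not change the limit direction. *)
Lemma feasible_correction n p (X : set 'rV[R]_n) (c : 'rV[R]_n -> 'rV[R]_p)
    (x d : 'rV[R]_n) (kappa eta : R) (t : nat -> R) (a : nat -> 'rV[R]_n) :
  c x = 0 -> differentiable c x -> d *m 'J c x = 0 -> 0 < kappa -> 0 < eta ->
  (forall y, X y -> `|y - x| <= eta ->
     exists2 y', feasible X c y' & `|y' - y| <= kappa * `|c y|) ->
  (forall k, 0 < t k) -> t @ \oo --> (0 : R) -> a @ \oo --> d ->
  (forall k, X (x + t k *: a k)) ->
  exists b : nat -> 'rV[R]_n,
    [/\ b @ \oo --> d, \forall k \near \oo, feasible X c (x + t k *: b k)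
      & (fun k => b k - a k) @ \oo --> (0 : 'rV[R]_n)].
Proof.
move=> cx0 dc dJ kappa0 eta0 eb t0 tt aa Xa.
have H k : exists b : 'rV[R]_n,
    `|b - a k| <= kappa * `|(t k)^-1 *: (c (x + t k *: a k) - c x)| /\
    (`|t k *: a k| <= eta -> feasible X c (x + t k *: b)).
  have tk0 : t k != 0 by rewrite gt_eqF.
  have [ale|ale] := leP `|t k *: a k| eta; last first.
    exists (a k); rewrite subrr normr0 mulr_ge0 ?(ltW kappa0) //; split=> //.
  have [|y' Fy' yy'] := eb _ (Xa k); first by rewrite addrAC subrr add0r.
  exists ((t k)^-1 *: (y' - x)); split=> [|_]; last first.
    by rewrite scalerA divff // scale1r addrC subrK.
  have -> : (t k)^-1 *: (y' - x) - a k = (t k)^-1 *: (y' - (x + t k *: a k)).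
    by rewrite opprD addrA [in RHS]scalerBr scalerA mulVf // scale1r.
  rewrite !normrZ cx0 subr0 mulrCA ler_wpM2l //.
have [b bP] := choice H; exists b.
have tn0 : \forall k \near \oo, t k != 0 by apply: nearW => k; rewrite gt_eqF.
have q0 : (fun k => (t k)^-1 *: (c (x + t k *: a k) - c x)) @ \oo --> (0 : 'rV[R]_p).
  by rewrite -dJ -diffE_jacobian; exact: cvg_diff_quotient.
have ba : (fun k => b k - a k) @ \oo --> (0 : 'rV[R]_n).
  apply/norm_cvg0P.
  apply: (@squeeze_cvgr _ _ _ _ (cst 0)
    (fun k => kappa * `|(t k)^-1 *: (c (x + t k *: a k) - c x)|)).
  - by apply: nearW => k; rewrite normr_ge0 /=; have [] := bP k.
  - exact: cvg_cst.
  - rewrite -(mulr0 kappa); apply: cvgMl_tmp.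
    by rewrite -(normr0 'rV[R]_p); exact: cvg_norm.
split=> //.
  have -> : b = (fun k => b k - a k) + a by apply/funext => k; rewrite fctE subrK.
  by rewrite -[d]add0r; exact: cvgD.
have ta : (fun k => t k *: a k) @ \oo --> (0 : 'rV[R]_n).
  by rewrite -(scale0r d); exact: cvgZ.
near=> k; have [_] := bP k; apply.
have : `|0 - t k *: a k| <= eta by near: k; apply: (cvgr_dist_le _ _ ta).
by rewrite sub0r normrN.
Unshelve. all: by end_near. Qed.

End LocalRegularity.

(** * Normals along a tangent direction and second-order tangents *)

Section SecondOrder.
Context {R : realType}.

(** The points are the projections onto [X] of [x + t k *: (d + v)].  Since [d] is
    tangent, [v] normal and the two are orthogonal, [d] is the projection of
    [d + v] onto the tangent cone, whence the projections move in direction [d]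
    to first order; the rescaled residuals of the projections are normal vectors
    which tend to [v]. *)
Lemma normal_sequence n (X : set 'rV[R]_n) (x d v : 'rV[R]_n)
    (t : nat -> R) (e : nat -> 'rV[R]_n) :
  closed X -> convex_set X -> normal_cone X x v -> dot v d = 0 ->
  (forall k, 0 < t k) -> e @ \oo --> d -> (forall k, X (x + t k *: e k)) ->
  exists a : nat -> 'rV[R]_n, [/\ a @ \oo --> d,
    forall k, X (x + t k *: a k)
  & forall k, normal_cone X (x + t k *: a k) (d + v - a k)].
Proof.
move=> Xcl cX Nv vd t0 ee Xe.
have H k : exists a : 'rV[R]_n, X (x + t k *: a) /\
    normal_cone X (x + t k *: a) (d + v - a).
  have tk0 : t k != 0 by rewrite gt_eqF.
  have [y Xy yP] := projection_convex (x + t k *: (d + v)) Xcl cX (Xe k).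
  have yE : x + t k *: ((t k)^-1 *: (y - x)) = y.
    by rewrite scalerA divff // scale1r addrC subrK.
  exists ((t k)^-1 *: (y - x)); rewrite yE; split=> // z Xz.
  have -> : d + v - (t k)^-1 *: (y - x) = (t k)^-1 *: (x + t k *: (d + v) - y).
    apply/rowP => j; rewrite !mxE; field; exact: tk0.
  by rewrite dotZl pmulr_rle0 ?invr_gt0 // yP.
have [a aP] := choice H; exists a; split; last 2 first.
- by move=> k; have [] := aP k.
- by move=> k; have [] := aP k.
have key k : dot (d - a k) (d - a k) <= dot (d - e k) (d - e k) + 2 * dot v (d - e k).
  have [Xa Na] := aP k.
  have h1 : dot (d + v - a k) (e k - a k) <= 0.
    have := Na _ (Xe k); rewrite opprD addrACA subrr add0r -scalerBr dotZr.
    by rewrite pmulr_rle0.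
  have h2 : dot v (a k) <= 0.
    by have := Nv _ Xa; rewrite addrAC subrr add0r dotZr pmulr_rle0.
  have h3 := dot_ge0 ((d - a k) - (d - e k)).
  move: h1 h2 h3; rewrite !(dotDl, dotDr, dotNl, dotNr) vd.
  rewrite [dot (e k) d]dotC [dot (a k) d]dotC [dot (e k) (a k)]dotC.
  lra.
have de : (fun k => d - e k) @ \oo --> (0 : 'rV[R]_n).
  have dd : (fun _ : nat => d) @ \oo --> d by exact: cvg_cst.
  by rewrite -(subrr d); exact: (cvgB dd ee).
have u0 : (fun k => dot (d - e k) (d - e k) + 2 * dot v (d - e k)) @ \oo --> (0 : R).
  have h1 : (fun k => dot (d - e k) (d - e k)) @ \oo --> dot (0 : 'rV[R]_n) 0.
    exact: (cvg_dot de de).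
  have h2 : (fun k => dot v (d - e k)) @ \oo --> dot v 0.
    have vv : (fun _ : nat => v) @ \oo --> v by exact: cvg_cst.
    exact: (cvg_dot vv de).
  have h3 : (fun k => 2 * dot v (d - e k)) @ \oo --> 2 * dot v 0.
    by apply: cvgMl_tmp; exact: h2.
  have h4 : (fun k => dot (d - e k) (d - e k) + 2 * dot v (d - e k)) @ \oo -->
      dot (0 : 'rV[R]_n) 0 + 2 * dot v 0 by exact: (cvgD h1 h3).
  by move: h4; rewrite !dot0r mulr0 addr0.
apply/cvgrPdist_le => eps eps0.
have e20 : 0 < eps ^+ 2 by rewrite exprn_gt0.
near=> k.
have : `|0 - (dot (d - e k) (d - e k) + 2 * dot v (d - e k))| <= eps ^+ 2.
  by near: k; apply: (cvgr_dist_le _ _ u0).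
rewrite sub0r normrN => /(le_trans (ler_norm _)) h.
rewrite (le_trans (ler_norm_enorm _)) //.
rewrite -(@ler_pXn2r _ 2) ?nnegrE ?sqrtr_ge0 ?(ltW eps0) //.
by rewrite enorm_sqr (le_trans (key k)).
Unshelve. all: by end_near. Qed.

(** The rescaled sets in the definition all lie in the orthogonal complement of
    [q], which stays at distance at least [`|dot q z| / M] from [z]. *)
Lemma second_order_tangent_dot n (X : set 'rV[R]_n) (x w q z : 'rV[R]_n) :
  (forall s, X s -> dot q (s - x) = 0) -> dot q w = 0 ->
  second_order_tangent X x w z -> dot q z = 0.
Proof.
move=> qX qw; rewrite /second_order_tangent /= limf_einfE => H.
apply/eqP/negPn/negP => qz0.
have c0 : 0 < `|dot q z| by rewrite normr_gt0.
pose M : R := n%:R * `|q| + 1.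
have M0 : 0 < M by rewrite ltr_wpDl // mulr_ge0.
have : ((`|dot q z| / M)%:E <= 0)%E.
  rewrite -H; apply: le_ereal_sup_tmp.
  exists (ereal_inf ((fun t => dist z [set (2^-1 * t ^+ 2)^-1 *: (s - x - t *: w)
    | s in X]) @` setT)).
    (* this bound holds for every t, so the whole line may serve as neighbourhood *)
    by exists setT => //; exact: filterT.
  apply/ereal_infP => _ [t _ <-].
  apply/ereal_infP => _ [_ [s Xs <-] <-].
  rewrite lee_fin ler_pdivrMr // mulrC.
  set u := _^-1 *: _.
  have qu : dot q u = 0 by rewrite /u dotZr dotBr dotZr qX // qw mulr0 subrr mulr0.
  have -> : dot q z = dot q (z - u) by rewrite dotBr qu subr0.
  rewrite (le_trans (ler_dot_norm _ _)) //.
  apply: (@le_trans _ _ (M * `|z - u|)); first by rewrite ler_wpM2r // lerDl.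
  by rewrite ler_wpM2l ?(ltW M0) // ler_norm_enorm.
by rewrite lee_fin leNgt divr_gt0.
Qed.

End SecondOrder.

(** * The dissolving mapping along feasible directions *)

Section Dissolving.
Context {R : realType}.

Lemma near_diff_eq0 (V W : normedModType R) (F : V -> W) (x d : V)
    (t : nat -> R) (b : nat -> V) :
  differentiable F x -> (forall k, 0 < t k) -> t @ \oo --> (0 : R) ->
  b @ \oo --> d -> (\forall k \near \oo, F (x + t k *: b k) = F x) ->
  'd F x d = 0.
Proof.
move=> dF t0 tt bb FE.
have tn0 : \forall k \near \oo, t k != 0 by apply: nearW => k; rewrite gt_eqF.
have q : (fun k => (t k)^-1 *: (F (x + t k *: b k) - F x)) @ \oo --> 'd F x d.
  exact: cvg_diff_quotient.
have q0 : (fun k => (t k)^-1 *: (F (x + t k *: b k) - F x)) @ \oo --> (0 : W).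
  apply: cvg_near_cst; apply: filterS FE => k ->.
  by rewrite subrr scaler0.
exact: (cvg_unique _ q q0).
Qed.

Lemma diff_id_along n (A : 'rV[R]_n -> 'rV[R]_n) (x d : 'rV[R]_n)
    (t : nat -> R) (b : nat -> 'rV[R]_n) :
  differentiable A x -> (forall k, 0 < t k) -> t @ \oo --> (0 : R) ->
  b @ \oo --> d -> A x = x ->
  (\forall k \near \oo, A (x + t k *: b k) = x + t k *: b k) ->
  d *m 'J A x = d.
Proof.
move=> dA t0 tt bb Ax AE.
have tn0 : \forall k \near \oo, t k != 0 by apply: nearW => k; rewrite gt_eqF.
have q : (fun k => (t k)^-1 *: (A (x + t k *: b k) - A x)) @ \oo --> 'd A x d.
  exact: cvg_diff_quotient.
have q0 : (fun k => (t k)^-1 *: (A (x + t k *: b k) - A x)) @ \oo --> d.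
  apply: cvg_trans bb; apply: near_eq_cvg; apply: filterS AE => k ->.
  by rewrite Ax addrAC subrr add0r scalerA mulVf ?scale1r // gt_eqF.
by rewrite -diffE_jacobian; exact: (cvg_unique _ q q0).
Qed.

(** Differentiate the identity ['J A y *m 'J c y = 0] along feasible points
    approaching [x] in direction [d], and evaluate at [d]. *)
Lemma diff_dissolving_product n p (c : 'rV[R]_n -> 'rV[R]_p)
    (A : 'rV[R]_n -> 'rV[R]_n) (x d : 'rV[R]_n) (t : nat -> R)
    (b : nat -> 'rV[R]_n) :
  differentiable (jacobian A) x -> differentiable (jacobian c) x ->
  (forall k, 0 < t k) -> t @ \oo --> (0 : R) -> b @ \oo --> d ->
  'J A x *m 'J c x = 0 ->
  (\forall k \near \oo,
     'J A (x + t k *: b k) *m 'J c (x + t k *: b k) = 0) ->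
  d *m 'J A x = d ->
  d *m 'd (jacobian A) x d *m 'J c x + d *m 'd (jacobian c) x d = 0.
Proof.
move=> dJA dJc t0 tt bb AC0 ACE dA.
have [dP PE] := diff_mulmx_fun dJA dJc.
have P0 : 'd (fun y => 'J A y *m 'J c y) x d = 0.
  apply: (near_diff_eq0 dP t0 tt bb).
  by apply: filterS ACE => k Ek; exact: (etrans Ek (esym AC0)).
have := congr1 (mulmx d) (etrans (esym (PE d)) P0).
move: dA ('d (jacobian A) x d) ('d (jacobian c) x d) => + G H.
move: (jacobian A x) (jacobian c x) => JA JC dA.
by rewrite mulmx0 mulmxDr !mulmxA dA.
Qed.

(** Choose points [y k] moving in direction [d] with normals [u k] tending to [v].
    The normal [u k] is annihilated by ['J A (y k) - 1%:M - RA (y k)], while [d] is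
    fixed by ['J A x]; hence [d *m ('J A (y k) - 'J A x)] pairs with [u k] as
    [d *m RA (y k)] does.  The points [y k] are at distance o(t k) from feasible
    ones, where [RA] vanishes, so [RA (y k)] is o(t k) by the Lipschitz property.
    Dividing by [t k] gives the claim. *)
Lemma normal_curvature n p (X : set 'rV[R]_n) (c : 'rV[R]_n -> 'rV[R]_p)
    (A : 'rV[R]_n -> 'rV[R]_n) (RA : 'rV[R]_n -> 'M[R]_n) (x d v : 'rV[R]_n)
    (t : nat -> R) (e : nat -> 'rV[R]_n) (kappa eta omega : R) :
  closed X -> convex_set X -> feasible X c x -> differentiable c x ->
  0 < kappa -> 0 < eta -> 0 < omega ->
  (forall y, X y -> `|y - x| <= eta ->
     exists2 y', feasible X c y' & `|y' - y| <= kappa * `|c y|) ->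
  (forall k, 0 < t k) -> t @ \oo --> (0 : R) -> e @ \oo --> d ->
  (forall k, X (x + t k *: e k)) ->
  differentiable (jacobian A) x ->
  [locally [lipschitz RA y | y in X]] ->
  (forall y, feasible X c y -> RA y = 0) ->
  (forall y, X y -> enorm (y - x) <= omega -> forall u, normal_cone X y u ->
     ('J A y - 1%:M - RA y) *m u^T = 0) ->
  d *m 'J c x = 0 -> d *m 'J A x = d ->
  normal_cone X x v -> dot v d = 0 ->
  dot (d *m 'd (jacobian A) x d) v = 0.
Proof.
move=> Xcl cX [Xx cx0] dc kappa0 eta0 omega0 eb t0 tt ee Xe dJA RL R0 RN dJc dA Nv vd.
have [a [aa Xa Na]] := normal_sequence Xcl cX Nv vd t0 ee Xe.
have [b [bb Fb ba]] := feasible_correction cx0 dc dJc kappa0 eta0 eb t0 tt aa Xa.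
have [r [L [r0 L0 RAL]]] := locally_lipschitz_ball RL Xx.
have tn0 : \forall k \near \oo, t k != 0 by apply: nearW => k; rewrite gt_eqF.
have ta : (fun k => t k *: a k) @ \oo --> (0 : 'rV[R]_n).
  by rewrite -(scale0r d); exact: cvgZ.
have tb : (fun k => t k *: b k) @ \oo --> (0 : 'rV[R]_n).
  by rewrite -(scale0r d); exact: cvgZ.
pose y k := x + t k *: a k.
have RA0 : (fun k => (t k)^-1 *: RA (y k)) @ \oo --> (0 : 'M[R]_n).
  apply/norm_cvg0P.
  apply: (@squeeze_cvgr _ _ _ _ (cst 0) (fun k => L * `|b k - a k|)).
  - near=> k; rewrite normr_ge0 /=.
    have Fk : feasible X c (x + t k *: b k) by near: k.
    have ak : `|0 - t k *: a k| < r by near: k; apply: (cvgr_dist_lt _ _ ta).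
    have bk : `|0 - t k *: b k| < r by near: k; apply: (cvgr_dist_lt _ _ tb).
    rewrite normrZ normfV (gtr0_norm (t0 k)) ler_pdivrMl //.
    have -> : RA (y k) = RA (y k) - RA (x + t k *: b k) by rewrite (R0 _ Fk) subr0.
    apply: (le_trans (RAL _ _ (Xa k) (proj1 Fk) _ _)).
    + by rewrite addrAC subrr add0r -normrN -sub0r.
    + by rewrite addrAC subrr add0r -normrN -sub0r.
    have -> : x + t k *: a k - (x + t k *: b k) = t k *: (a k - b k).
      by rewrite opprD addrACA subrr add0r -scalerBr.
    by rewrite normrZ (gtr0_norm (t0 k)) distrC mulrCA.
  - exact: cvg_cst.
  - rewrite -(mulr0 L); apply: cvgMl_tmp.
    by rewrite -(normr0 'rV[R]_n); exact: cvg_norm.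
have JAq : (fun k => (t k)^-1 *: ('J A (y k) - 'J A x)) @ \oo -->
    'd (jacobian A) x d.
  exact: (cvg_diff_quotient dJA tn0 tt aa).
pose M k := (t k)^-1 *: ('J A (y k) - 'J A x) - (t k)^-1 *: RA (y k).
have MH : M @ \oo --> 'd (jacobian A) x d.
  by rewrite -['d _ x d]subr0; exact: (cvgB JAq RA0).
have vv : (fun k => d + v - a k) @ \oo --> v.
  have dd : (fun _ : nat => d + v) @ \oo --> d + v by exact: cvg_cst.
  have h : (fun k => d + v - a k) @ \oo --> d + v - d by exact: (cvgB dd aa).
  by move: h; have -> : d + v - d = v by rewrite addrAC subrr add0r.
have dM : (fun k => d *m M k) @ \oo --> d *m 'd (jacobian A) x d.
  have dd : (fun _ : nat => d) @ \oo --> d by exact: cvg_cst.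
  exact: (cvg_mulmx dd MH).
have lim1 : (fun k => dot (d *m M k) (d + v - a k)) @ \oo -->
    dot (d *m 'd (jacobian A) x d) v by exact: (cvg_dot dM vv).
have lim0 : (fun k => dot (d *m M k) (d + v - a k)) @ \oo --> (0 : R).
  apply: cvg_near_cst; near=> k.
  have yx : enorm (y k - x) <= omega.
    rewrite (le_trans (enorm_le _)) // addrAC subrr add0r.
    have n10 : 0 < n%:R + 1 :> R by rewrite ltr_wpDl.
    rewrite mulrC -ler_pdivlMr // -normrN -sub0r.
    by near: k; apply: (cvgr_dist_le _ _ ta); rewrite divr_gt0.
  have E : d *m M k = (t k)^-1 *: (d *m ('J A (y k) - 1%:M - RA (y k))).
    rewrite /M -scalerBr -scalemxAr; congr (_ *: _).
    have gen (P Q S : 'M[R]_n) : d *m Q = d ->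
        d *m (P - Q - S) = d *m (P - 1%:M - S).
      by move=> dQ; rewrite !mulmxBr dQ mulmx1.
    exact: gen.
  rewrite E dotZl /dot -mulmxA (RN _ (Xa k) yx _ (Na k)).
  by rewrite mulmx0 mxE mulr0.
exact: (cvg_unique _ lim1 lim0).
Unshelve. all: by end_near. Qed.

End Dissolving.

(** * Multipliers *)

Section Multipliers.
Context {R : realType}.

Lemma tangent_cone_frame n r (X : set 'rV[R]_n) (x : 'rV[R]_n)
    (K : 'M[R]_(r, n)) (a : 'rV[R]_r) :
  convex_set X -> X x ->
  (forall i (b : bool), tangent_cone X x ((-1) ^+ b *: row i K)) ->
  tangent_cone X x (a *m K).
Proof.
move=> cX Xx TK; rewrite mulmx_sum_row; apply: tangent_cone_sum => // i.
rewrite [a 0 i]numEsign mulrC -scalerA.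
exact: tangent_coneZ.
Qed.

(** On tangent directions in the kernel of [JC] the map [JA] is the identity, so
    [g] and [g *m JA^T] agree there.  Any tangent direction [d] becomes such a
    direction after subtracting [d *m JC *m W *m K], and this projection
    determines [l]: what remains of [g - g *m JA^T] is orthogonal to the tangent
    cone. *)
Lemma dissolving_multiplier n p r (X : set 'rV[R]_n) (x g : 'rV[R]_n)
    (JC : 'M[R]_(n, p)) (JA : 'M[R]_n) (K : 'M[R]_(r, n)) (W : 'M[R]_(p, r)) :
  convex_set X -> X x ->
  (forall i (b : bool), tangent_cone X x ((-1) ^+ b *: row i K)) ->
  K *m JC *m W = 1%:M ->
  (forall d, direction X x d -> exists a : 'rV[R]_r, d *m JC = a *m (K *m JC)) ->
  (forall d, tangent_cone X x d -> d *m JC = 0 -> d *m JA = d) ->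
  exists (l : 'rV[R]_p) (q : 'rV[R]_n),
    g + l *m JC^T + (q - g *m JA^T) = 0 /\
    forall d, tangent_cone X x d -> dot q d = 0.
Proof.
move=> cX Xx TK KJW span fixA.
pose l := - (g *m (W *m K *m (1%:M - JA))^T).
exists l, (g *m JA^T - g - l *m JC^T); split.
  by apply/rowP => j; rewrite !mxE; ring.
move=> d Td.
have [a aE] := span d (tangent_cone_direction Xx Td).
pose d' := d - d *m JC *m W *m K.
have Td' : tangent_cone X x d'.
  rewrite /d' -mulNmx; apply: tangent_coneD => //; exact: tangent_cone_frame.
have d'C : d' *m JC = 0.
  have E0 : d *m JC *m W *m K = a *m K.
    by rewrite aE -[a *m (K *m JC) *m W]mulmxA KJW mulmx1.
  by rewrite /d' E0 mulmxBl aE mulmxA subrr.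
have dA := fixA d' Td' d'C.
rewrite /d' mulmxBl in dA; set u := d *m JC *m W *m K in dA.
have El : dot (l *m JC^T) d = - (dot g u - dot g (u *m JA)).
  by rewrite dot_mulmx trmxK /l dotNl dot_mulmx trmxK !mulmxA mulmxBr mulmx1 dotBr.
have := congr1 (dot g) dA; rewrite !dotBr => E.
rewrite !dotBl El dot_mulmx trmxK.
lra.
Qed.

End Multipliers.

Lemma support_eq {R : realType} n (u v : 'rV[R]_n) (S : set 'rV[R]_n) :
  (forall y, S y -> dot u y = dot v y) -> Defs.support u S = Defs.support v S.
Proof.
move=> uv; congr ereal_sup; apply/seteqP; split=> _ [y Sy <-].
  by exists y; rewrite ?uv.
by exists y; rewrite ?uv.
Qed.

Theorem theorem3p19 (R : realType) (n p : nat) (X Y : set 'rV[R]_n)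
    (f : 'rV[R]_n -> R) (c : 'rV[R]_n -> 'rV[R]_p)
    (A : 'rV[R]_n -> 'rV[R]_n) (beta : R) :
  closed X -> convex_set X -> open Y -> X `<=` Y ->
  regular_data X Y f c ->
  constraint_dissolving X c A ->
  twice_differentiable Y f (grad f) ->
  twice_differentiable Y c (jacobian c) ->
  twice_differentiable Y A (jacobian A) ->
  0 <= beta ->
  forall x : 'rV[R]_n, feasible X c x ->
    cdp_stationary2 X (cdp_obj f c A beta) x ->
    ncp_stationary2 X f c x.
Proof.
move=> Xcl cX oY XY reg [_ AK [RA [RL R0 RN]]] f2 c2 A2 _ x Fx [[_ [v Nv v0]] so].
have [Xx cx0] := Fx.
have [r [K [W [TK KJW span [kappa [eta [kappa0 eta0 eb]]]]]]] :=
  local_regularity Xcl cX oY XY reg Fx.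
have Yx := XY x Xx.
have nY : \forall y \near x, Y y by exact: open_nbhs_nbhs.
have [Ax AC0] := AK x Fx.
have [dcx dJc] := c2 x Yx.
have [dAx dJA] := A2 x Yx.
have [dfx dgf] := f2 x Yx.
have [[df _ _] _ _] := reg.
have dfA y : differentiable f y by exact: df.
set h := cdp_obj f c A beta in v0 so.
have gh : grad h x = grad f x *m ('J A x)^T.
  by rewrite /h grad_cdp_obj // Ax cx0 mul0mx scaler0 addr0.
have fixA d : tangent_cone X x d -> d *m 'J c x = 0 -> d *m 'J A x = d.
  move=> [t [e [t0 tt ee Xe]]] dJ.
  have [b [bb Fb _]] := feasible_correction cx0 dcx dJ kappa0 eta0 eb t0 tt ee Xe.
  apply: (diff_id_along dAx t0 tt bb Ax).
  by apply: filterS Fb => k /AK[].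
have [l [q [lq qT]]] := dissolving_multiplier (grad f x) cX Xx TK KJW span fixA.
pose G := q - grad h x.
have GE : grad f x + l *m ('J c x)^T + G = 0 by rewrite /G gh.
have NG : normal_cone X x G.
  move=> y Xy; rewrite /G dotBl qT; last exact: tangent_cone_feasible.
  have : v = - grad h x by apply/eqP; rewrite -addr_eq0 addrC -v0.
  by move=> vE; rewrite sub0r -dotNl -vE; exact: Nv.
split.
  by split=> //; exists l, G; split=> //; rewrite GE.
move=> d [Td fd dJ].
have dA := fixA d Td dJ.
have hd : dot d (grad h x) = 0.
  by rewrite gh dotC dot_mulmx trmxK dA.
have Gd : dot G d = 0 by rewrite /G dotBl qT // [dot (grad h x) d]dotC hd subr0.
have [t [e [t0 tt ee Xe]]] := Td.
have [b [bb Fb _]] := feasible_correction cx0 dcx dJ kappa0 eta0 eb t0 tt ee Xe.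
have AC : d *m 'd (jacobian A) x d *m 'J c x + d *m 'd (jacobian c) x d = 0.
  apply: (diff_dissolving_product dJA dJc t0 tt bb AC0 _ dA).
  by apply: filterS Fb => k /AK[].
have [omega omega0 RNx] := RN x Fx.
have curv : dot (d *m 'd (jacobian A) x d) G = 0.
  exact: (normal_curvature Xcl cX Fx dcx kappa0 eta0 omega0 eb t0 tt ee Xe dJA
    RL R0 RNx dJ dA NG Gd).
have quadE : quad_form (hess h x) d = quad_form (hess f x + hess_comb c l x) d.
  have QC : quad_form (hess_comb c l x) d = dot l (d *m 'd (jacobian c) x d).
    apply: quad_form_hess_comb => //.
    by apply: filterS nY => y /c2[].
  have QH : quad_form (hess h x) d =
      quad_form (hess f x) d + dot (grad f x) (d *m 'd (jacobian A) x d).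
    apply: quad_form_hess_cdp_obj => //.
      by apply: filterS nY => y /c2[].
    by apply: filterS nY => y /A2[].
  have QD (M N : 'M[R]_n) : quad_form (M + N) d = quad_form M d + quad_form N d.
    by rewrite !quad_formE mulmxDr dotDl.
  have alg (gf : 'rV[R]_n) (JC H2 : 'M[R]_(n, p)) (H1 : 'M[R]_n) :
      gf + l *m JC^T + G = 0 -> d *m H1 *m JC + d *m H2 = 0 ->
      dot (d *m H1) G = 0 -> dot gf (d *m H1) = dot l (d *m H2).
    move=> E1 E2 E3.
    have -> : d *m H2 = - (d *m H1 *m JC).
      by apply/eqP; rewrite -addr_eq0 addrC E2.
    have -> : gf = - (l *m JC^T + G).
      by apply/eqP; rewrite -addr_eq0 addrA E1.
    by rewrite dotNl dotDl [dot G _]dotC E3 addr0 dot_mulmx trmxK dotNr.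
  apply: (etrans QH); apply: (etrans _ (esym (QD _ _))).
  apply: (congr1 (fun w => _ + w)); apply: (etrans _ (esym QC)).
  exact: (alg _ _ _ _ GE AC curv).
have supE : Defs.support (- grad h x) (second_order_tangent X x d) =
    Defs.support G (second_order_tangent X x d).
  apply: support_eq => z Tz.
  have qz : dot q z = 0.
    apply: second_order_tangent_dot Tz; last exact: qT.
    by move=> s Xs; apply: qT; exact: tangent_cone_feasible.
  by rewrite /G dotBl dotNl qz sub0r.
apply: le_ereal_sup_tmp.
exists ((quad_form (hess f x + hess_comb c l x) d)%:E
   - Defs.support G (second_order_tangent X x d))%E; first by exists (l, G).
rewrite -quadE -supE; apply: so; split => //.
Qed.
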